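(* Every hat (basic or triangulated) with valid parameters $\alpha,\beta,\gamma$ satisfying $\alpha>2\beta+\gamma$ (with $\gamma=0$ for basic hats) is an open convex-faced polyhedron with no edge unfolding.
   Context: A polyhedron is a connected set of closed planar polygons in $\mathbb{R}^3$ such that any intersection of two of them is a collection of common vertices and edges, and each edge is shared by at most two polygons; it is open if some edge belongs to only one polygon (boundary edges). Convex-faced: every face has all interior angles strictly less than $\pi$. A cutting of $P$ is a union $C$ of finitely many line segments on $P$, containing only finitely many boundary points of $P$, such that $P-C$ is connected and can be isometrically embedded in the plane without overlap; an edge cutting is a cutting that is a union of edges of $P$, and the result is an edge unfolding. Hats: open polyhedra with equilateral-triangle boundary; boundary vertices are corners, the innermost vertex is the tip, and there are three middle vertices. The spike consists of the three triangles incident to the tip: congruent isosceles triangles with base angles $\alpha$ and unit base edges, whose base vertices are the middle vertices. Basic hat: $30^\circ\le\alpha,\beta<90^\circ$, $\ell>1$, $\gamma=0$; brim = three congruent symmetric trapezoids with lower angles $\beta$, top side a spike base edge (length 1), bottom side a boundary edge (length $\ell$). Triangulated hat: $30^\circ\le\alpha<90^\circ$, $30^\circ\le\beta+\gamma/2<90^\circ$, $\gamma<60^\circ$; brim = three congruent isosceles triangles with bases the boundary edges, base angles $\beta$ and apex at a middle vertex, plus three congruent isosceles triangles with bases the spike base edges and apex angle $\gamma$ at a corner. Valid parameters are those satisfying these constraints. *)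

(* Defs.v *)
From HB Require Import structures.
From mathcomp Require Import all_boot all_order all_algebra.
From mathcomp Require Import all_classical all_reals all_analysis.
Import Order.TTheory GRing.Theory Num.Theory.
Import numFieldNormedType.Exports.

Set Implicit Arguments.
Unset Strict Implicit.
Unset Printing Implicit Defensive.

Local Open Scope classical_set_scope.
Local Open Scope ring_scope.

Section Geometry.
Variable R : realType.

Definition dotv n (u v : 'rV[R]_n) : R := \sum_(i < n) u ord0 i * v ord0 i.
Definition enorm n (u : 'rV[R]_n) : R := Num.sqrt (dotv u u).
Definition edist n (x y : 'rV[R]_n) : R := enorm (x - y).
Definition vangle n (u v : 'rV[R]_n) : R :=
  acos (dotv u v / (enorm u * enorm v)).

Definition segment n (a b : 'rV[R]_n) : set 'rV[R]_n :=
  [set x | exists t : R, 0 <= t <= 1 /\ x = (1 - t) *: a + t *: b].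

(** A face is given by the list of its vertices in cyclic order. *)
Definition face := seq 'rV[R]_3.

(** The closed region of a (convex) polygon: the convex hull of its vertices.
    All faces to which this is applied below (triangles and symmetric
    trapezoids listed in cyclic order) are convex, so this is the closed
    planar polygon. *)
Definition region (F : face) : set 'rV[R]_3 :=
  [set x | exists w : 'I_(size F) -> R,
     (forall i, 0 <= w i) /\ \sum_i w i = 1 /\ x = \sum_i w i *: F`_i].

Definition edges (F : face) : seq ('rV[R]_3 * 'rV[R]_3) :=
  [seq (F`_i, F`_(i.+1 %% size F)) | i <- iota 0 (size F)].

Definition same_edge (e e' : 'rV[R]_3 * 'rV[R]_3) : bool :=
  ((e.1 == e'.1) && (e.2 == e'.2)) || ((e.1 == e'.2) && (e.2 == e'.1)).

Definition is_edge_of (F : face) e : bool := has (same_edge e) (edges F).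

Definition nfaces_at (P : seq face) e : nat := count (fun F => is_edge_of F e) P.

Definition planar_polygon (F : face) : Prop :=
  [/\ (3 <= size F)%N, uniq F,
      (exists nv : 'rV[R]_3, nv != 0 /\ exists d : R,
          forall v, v \in F -> dotv nv v = d) &
      (exists a b c, [/\ a \in F, b \in F, c \in F &
          forall s t : R, s *: (b - a) + t *: (c - a) = 0 -> s = 0 /\ t = 0])].

Definition surface (P : seq face) : set 'rV[R]_3 :=
  [set x | exists2 F, F \in P & region F x].

Definition common_part (F G : face) : set 'rV[R]_3 :=
  [set x | (exists v, [/\ v \in F, v \in G & x = v]) \/
           (exists e, [/\ e \in edges F, is_edge_of G e & segment e.1 e.2 x])].

Definition polyhedron (P : seq face) : Prop :=
  [/\ forall F, F \in P -> planar_polygon F,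
      forall i j, (i < size P)%N -> (j < size P)%N -> i != j ->
        region (nth [::] P i) `&` region (nth [::] P j)
        = common_part (nth [::] P i) (nth [::] P j),
      forall e, (nfaces_at P e <= 2)%N &
      connected (surface P)].

Definition boundary (P : seq face) : set 'rV[R]_3 :=
  [set x | exists e, nfaces_at P e = 1%N /\ segment e.1 e.2 x].

Definition open_polyhedron (P : seq face) : Prop :=
  polyhedron P /\ exists e, nfaces_at P e = 1%N.

Definition interior_angle (F : face) (k : nat) : R :=
  vangle (F`_((k + size F).-1 %% size F) - F`_k) (F`_(k.+1 %% size F) - F`_k).

Definition convex_faced (P : seq face) : Prop :=
  forall F, F \in P -> forall k, (k < size F)%N -> interior_angle F k < pi.

Definition cutset (E : seq ('rV[R]_3 * 'rV[R]_3)) : set 'rV[R]_3 :=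
  [set x | exists2 e, e \in E & segment e.1 e.2 x].

Definition edge_unfolding (P : seq face) (E : seq ('rV[R]_3 * 'rV[R]_3)) : Prop :=
  [/\ forall e, e \in E -> exists2 F, F \in P & is_edge_of F e,
      finite_set (cutset E `&` boundary P),
      connected (surface P `\` cutset E) &
      exists f : 'rV[R]_3 -> 'rV[R]_2,
        (forall x y, (surface P `\` cutset E) x -> (surface P `\` cutset E) y ->
            f x = f y -> x = y) /\
        (forall F, F \in P -> forall x y,
            (region F `\` cutset E) x -> (region F `\` cutset E) y ->
            edist (f x) (f y) = edist x y)].

Definition has_edge_unfolding (P : seq face) : Prop :=
  exists E, edge_unfolding P E.

(** tip T, middle vertices M1 M2 M3, corners C1 C2 C3 *)

Definition spike_ok (a : R) (T Ma Mb : 'rV[R]_3) : Prop :=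
  [/\ edist Ma Mb = 1, vangle (Mb - Ma) (T - Ma) = a & vangle (Ma - Mb) (T - Mb) = a].

Definition trapezoid_ok (b l : R) (Ma Mb Ca Cb : 'rV[R]_3) : Prop :=
  [/\ edist Ca Cb = l, Mb - Ma = l^-1 *: (Cb - Ca),
      vangle (Cb - Ca) (Ma - Ca) = b & vangle (Ca - Cb) (Mb - Cb) = b].

Definition basic_hat_faces (T M1 M2 M3 C1 C2 C3 : 'rV[R]_3) : seq face :=
  [:: [:: T; M1; M2]; [:: T; M2; M3]; [:: T; M3; M1];
      [:: M1; M2; C2; C1]; [:: M2; M3; C3; C2]; [:: M3; M1; C1; C3]].

Definition basic_hat (a b l : R) (T M1 M2 M3 C1 C2 C3 : 'rV[R]_3) : Prop :=
  [/\ spike_ok a T M1 M2, spike_ok a T M2 M3, spike_ok a T M3 M1,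
      [/\ trapezoid_ok b l M1 M2 C1 C2, trapezoid_ok b l M2 M3 C2 C3 &
          trapezoid_ok b l M3 M1 C3 C1] &
      polyhedron (basic_hat_faces T M1 M2 M3 C1 C2 C3)].

Definition basic_valid (a b l : R) : Prop :=
  [/\ pi / 6 <= a < pi / 2, pi / 6 <= b < pi / 2 & 1 < l].

(** triangulated brim: triangle Ma Mb Ca (base Ma Mb, apex angle g at the
    corner Ca, isosceles) and triangle Ca Cb Mb (base the boundary edge
    Ca Cb, base angles b, apex at the middle vertex Mb) *)
Definition brim_tri_ok (b g : R) (Ma Mb Ca Cb : 'rV[R]_3) : Prop :=
  [/\ vangle (Ma - Ca) (Mb - Ca) = g, edist Ca Ma = edist Ca Mb,
      vangle (Cb - Ca) (Mb - Ca) = b & vangle (Ca - Cb) (Mb - Cb) = b].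

Definition triangulated_hat_faces (T M1 M2 M3 C1 C2 C3 : 'rV[R]_3) : seq face :=
  [:: [:: T; M1; M2]; [:: T; M2; M3]; [:: T; M3; M1];
      [:: M1; M2; C1]; [:: C1; C2; M2];
      [:: M2; M3; C2]; [:: C2; C3; M3];
      [:: M3; M1; C3]; [:: C3; C1; M1]].

Definition triangulated_hat (a b g : R) (T M1 M2 M3 C1 C2 C3 : 'rV[R]_3) : Prop :=
  [/\ [/\ spike_ok a T M1 M2, spike_ok a T M2 M3 & spike_ok a T M3 M1],
      [/\ brim_tri_ok b g M1 M2 C1 C2, brim_tri_ok b g M2 M3 C2 C3 &
          brim_tri_ok b g M3 M1 C3 C1],
      (edist C1 C2 = edist C2 C3 /\ edist C2 C3 = edist C3 C1) &
      polyhedron (triangulated_hat_faces T M1 M2 M3 C1 C2 C3)].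

Definition triangulated_valid (a b g : R) : Prop :=
  [/\ pi / 6 <= a < pi / 2, pi / 6 <= b + g / 2 < pi / 2 & g < pi / 3].

End Geometry.

(* Main.v *)
(** A middle vertex has total face angle larger than 2 pi, and so large that it
    still exceeds 2 pi when one face of the spike is removed: this is where
    2 b + g < a is used. Unfolding consecutive faces around a vertex whose common
    edges are uncut lays their angles side by side in the plane, so injectivity
    bounds the sum of these angles by 2 pi. Hence at each middle vertex the cut
    edges meet every arc of consecutive faces that is this wide. An edge set with
    this property contains the middle triangle, or a path joining two corners (or
    the same corner twice) through middle vertices and possibly the tip; each of
    these disconnects the surface. *)

Require Import Defs.
From mathcomp Require Import all_boot all_order all_algebra.
From mathcomp Require Import all_classical all_reals all_analysis.
From mathcomp Require Import ring lra.
Import Order.TTheory GRing.Theory Num.Theory.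
Import numFieldNormedType.Exports.
Local Open Scope ring_scope.
Local Notation edist := Defs.edist.
Set Implicit Arguments.
Unset Strict Implicit.
Unset Printing Implicit Defensive.

(** The angles at a middle vertex are a, pi - b, pi - b, a on a basic hat and a, (pi - g) / 2, pi -
    2 b, (pi - g) / 2, a on a triangulated one, so leaving out one spike face still leaves 2 pi + a
    - 2 b, or 2 pi + a - 2 b - g. The unfolding [f] is only an isometry on each face minus the cuts,
    and globally injective: it is not assumed continuous, it may be meaningless at the vertex
    itself, which can lie on a cut, and it might reflect some faces. So the images of neighbouring
    faces are tied together only through interior points of their uncut common edge, and every
    overlap is exhibited as an explicit pair of points. What remains is a finite question about the
    edge graph of the hat. It is settled by computation over all sets of inner edges, on copies of
    the faces whose vertices are numbers. *)

(** * Euclidean inner product and angles *)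

Section DotProduct.
Variables (R : realType) (n : nat).
Implicit Types u v w : 'rV[R]_n.

Lemma dotvC u v : dotv u v = dotv v u.
Proof. by apply: eq_bigr => i _; rewrite mulrC. Qed.

Lemma dotvDl u v w : dotv (u + v) w = dotv u w + dotv v w.
Proof. by rewrite -big_split; apply: eq_bigr => i _; rewrite mxE mulrDl. Qed.

Lemma dotvZl a u v : dotv (a *: u) v = a * dotv u v.
Proof. by rewrite /dotv mulr_sumr; apply: eq_bigr => i _; rewrite mxE mulrA. Qed.

Lemma dotvNl u v : dotv (- u) v = - dotv u v.
Proof. by rewrite -scaleN1r dotvZl mulN1r. Qed.

Lemma dotvDr u v w : dotv u (v + w) = dotv u v + dotv u w.
Proof. by rewrite dotvC dotvDl !(dotvC u). Qed.

Lemma dotvZr a u v : dotv u (a *: v) = a * dotv u v.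
Proof. by rewrite dotvC dotvZl dotvC. Qed.

Lemma dotvNr u v : dotv u (- v) = - dotv u v.
Proof. by rewrite dotvC dotvNl dotvC. Qed.

Lemma dotv0l u : dotv 0 u = 0.
Proof. by rewrite -(scale0r u) dotvZl mul0r. Qed.

Definition dotvE := (dotvDl, dotvDr, dotvNl, dotvNr, dotvZl, dotvZr).

Lemma dotvv_ge0 u : 0 <= dotv u u.
Proof. by apply: sumr_ge0 => i _; rewrite -expr2 sqr_ge0. Qed.

Lemma dotvv_eq0 u : dotv u u = 0 -> u = 0.
Proof.
move=> /eqP; rewrite psumr_eq0 => [/allP u0|i _]; last by rewrite -expr2 sqr_ge0.
apply/rowP => i; have := u0 i (mem_index_enum _).
by rewrite mxE (ord1 0) mulf_eq0 orbb => /eqP.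
Qed.

Lemma dotvv_gt0 u : u != 0 -> 0 < dotv u u.
Proof.
move=> u0; rewrite lt_def dotvv_ge0 andbT; apply: contra_neq u0.
exact: dotvv_eq0.
Qed.

Lemma enorm_ge0 u : 0 <= enorm u.
Proof. exact: sqrtr_ge0. Qed.

Lemma enorm_sqr u : enorm u ^+ 2 = dotv u u.
Proof. by rewrite sqr_sqrtr ?dotvv_ge0. Qed.

Lemma enorm_gt0 u : u != 0 -> 0 < enorm u.
Proof. by move=> u0; rewrite sqrtr_gt0 dotvv_gt0. Qed.

Lemma enormN u : enorm (- u) = enorm u.
Proof. by rewrite /enorm !dotvE opprK. Qed.

Lemma cauchy_schwarz u v : dotv u v ^+ 2 <= dotv u u * dotv v v.
Proof.
have [->|v0] := eqVneq v 0.
  by rewrite dotvC !dotv0l expr0n mulr0.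
have vv := dotvv_gt0 v0.
have := dotvv_ge0 (dotv v v *: u - dotv u v *: v).
rewrite !dotvE (dotvC v u).
set x := dotv u u; set y := dotv u v; set z := dotv v v => h.
have : 0 <= z * (x * z - y ^+ 2) by move: h; congr (0 <= _); ring.
by rewrite pmulr_rge0 // subr_ge0.
Qed.

(** The Gram determinant, the squared area of the parallelogram on [u] and [v]: it is positive
    exactly when they are independent. *)
Definition gram u v := dotv u u * dotv v v - dotv u v ^+ 2.

Lemma cosine_bounds u v : u != 0 -> v != 0 ->
  -1 <= dotv u v / (enorm u * enorm v) <= 1.
Proof.
move=> u0 v0; have p : 0 < enorm u * enorm v by rewrite mulr_gt0 ?enorm_gt0.
rewrite -ler_norml normrM normfV (gtr0_norm p) ler_pdivrMr // mul1r.
rewrite -(ler_pXn2r (_ : 0 < 2)%N) ?nnegrE ?normr_ge0 ?(ltW p) //.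
by rewrite real_normK ?num_real // exprMn !enorm_sqr cauchy_schwarz.
Qed.

Lemma cos_vangle u v : u != 0 -> v != 0 ->
  dotv u v = enorm u * enorm v * cos (vangle u v).
Proof.
move=> u0 v0; rewrite acosK ?in_itv ?cosine_bounds // mulrC divfK //.
by rewrite mulf_neq0 // gt_eqF ?enorm_gt0.
Qed.

Lemma vangle_ge0 u v : u != 0 -> v != 0 -> 0 <= vangle u v.
Proof. by move=> u0 v0; apply: acos_ge0; exact: cosine_bounds. Qed.

Lemma vangle_lt_pi u v : 0 < gram u v -> vangle u v < pi.
Proof.
rewrite subr_gt0 => uv.
have u0 : u != 0 by apply: contraTneq uv => ->; rewrite !dotv0l mul0r expr0n ltxx.
have v0 : v != 0.
  by apply: contraTneq uv => ->; rewrite dotvC !dotv0l mulr0 expr0n ltxx.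
have p : 0 < enorm u * enorm v by rewrite mulr_gt0 ?enorm_gt0.
have : `|dotv u v / (enorm u * enorm v)| < 1.
  rewrite normrM normfV (gtr0_norm p) ltr_pdivrMr // mul1r.
  rewrite -(ltr_pXn2r (_ : 0 < 2)%N) ?nnegrE ?normr_ge0 ?(ltW p) //.
  by rewrite real_normK ?num_real // exprMn !enorm_sqr.
by rewrite ltr_norml => /andP[l1 /ltW l2]; apply: acos_ltpi; rewrite l1.
Qed.

(** On a zero vector [vangle] takes the default value acos 0, so an equation about it says little.
    This form carries the nondegeneracy along and turns angle facts into algebra on [dotv]. *)
Definition has_angle u v t :=
  [/\ u != 0, v != 0, 0 < t < pi & dotv u v = enorm u * enorm v * cos t].

Lemma has_angle_sym u v t : has_angle u v t -> has_angle v u t.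
Proof. by case=> u0 v0 t0 uv; split => //; rewrite dotvC uv (mulrC (enorm u)). Qed.

Lemma has_angle_vangle u v t :
  u != 0 -> v != 0 -> 0 < t < pi -> vangle u v = t -> has_angle u v t.
Proof. by move=> u0 v0 t0 uv; split => //; rewrite cos_vangle // uv. Qed.

Lemma has_angle_gram u v t : has_angle u v t -> 0 < gram u v.
Proof.
move=> [u0 v0 t0 uv]; rewrite /gram uv !exprMn !enorm_sqr cos2sin2.
rewrite (_ : _ - _ = dotv u u * dotv v v * sin t ^+ 2); last by ring.
by rewrite !mulr_gt0 ?dotvv_gt0 ?exprn_gt0 ?sin_gt0_pi.
Qed.

End DotProduct.

(** * Isometries on arbitrary subsets of Euclidean space *)

Section IsometryIsAffine.
Variables (R : realType) (n m : nat) (f : 'rV[R]_n -> 'rV[R]_m).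
Variable (S : set 'rV[R]_n).
Hypothesis f_iso : forall x y, S x -> S y -> edist (f x) (f y) = edist x y.

Lemma isometry_dot x y z : S x -> S y -> S z ->
  dotv (f x - f z) (f y - f z) = dotv (x - z) (y - z).
Proof.
move=> Sx Sy Sz.
have iso a b : S a -> S b ->
    dotv (f a - f b) (f a - f b) = dotv (a - b) (a - b).
  by move=> Sa Sb; rewrite -!enorm_sqr -!/(edist _ _) f_iso.
have polar p (a b c : 'rV[R]_p) : dotv (a - c) (b - c) =
    (dotv (a - c) (a - c) + dotv (b - c) (b - c) - dotv (a - b) (a - b)) / 2.
  rewrite !dotvE (dotvC b a) (dotvC c a) (dotvC c b); lra.
by rewrite polar !iso // -polar.
Qed.

(** The squared norm of the difference of the two sides is a polynomial in inner products that [f]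
    preserves, so it equals the same expression before applying [f], which is 0. *)
Lemma isometry_affine x0 x1 x2 x s t : S x0 -> S x1 -> S x2 -> S x ->
  x - x0 = s *: (x1 - x0) + t *: (x2 - x0) ->
  f x - f x0 = s *: (f x1 - f x0) + t *: (f x2 - f x0).
Proof.
move=> S0 S1 S2 Sx xE; apply/eqP; rewrite -subr_eq0; apply/eqP/dotvv_eq0.
have expand p (d d1 d2 : 'rV[R]_p) :
    dotv (d - (s *: d1 + t *: d2)) (d - (s *: d1 + t *: d2)) =
    dotv d d + s ^+ 2 * dotv d1 d1 + t ^+ 2 * dotv d2 d2
    - s * dotv d d1 *+ 2 - t * dotv d d2 *+ 2 + s * t * dotv d1 d2 *+ 2.
  rewrite !dotvE (dotvC d1 d) (dotvC d2 d) (dotvC d2 d1); ring.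
by rewrite expand !isometry_dot // -expand xE subrr dotv0l.
Qed.

End IsometryIsAffine.

(** * Rotations of the plane *)

Section Rotation.
Variable R : realType.
Implicit Types (u v w : 'rV[R]_2) (s t x y z a c : R).

Lemma rV2P u v : u 0 0 = v 0 0 -> u 0 1 = v 0 1 -> u = v.
Proof.
move=> h0 h1; apply/rowP => i.
have [->|->] // : i = 0 \/ i = 1.
by case: i => -[|[|//]] ?; [left|right]; apply: val_inj.
Qed.

Lemma dotv2 u v : dotv u v = u 0 0 * v 0 0 + u 0 1 * v 0 1.
Proof.
rewrite /dotv !big_ord_recl big_ord0 addr0.
by congr (u _ _ * v _ _ + u _ _ * v _ _); apply: val_inj.
Qed.

Definition turn x w : 'rV[R]_2 :=
  \row_i (if i == 0 then cos x * w 0 0 - sin x * w 0 1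
          else sin x * w 0 0 + cos x * w 0 1).

Lemma turnE0 x w : (turn x w) 0 0 = cos x * w 0 0 - sin x * w 0 1.
Proof. by rewrite mxE. Qed.

Lemma turnE1 x w : (turn x w) 0 1 = sin x * w 0 0 + cos x * w 0 1.
Proof. by rewrite mxE. Qed.

Definition turnE := (turnE0, turnE1).

Lemma turnD x y w : turn (x + y) w = turn x (turn y w).
Proof. by apply: rV2P; rewrite !turnE sinD cosD; ring. Qed.

Lemma turn0 w : turn 0 w = w.
Proof. by apply: rV2P; rewrite !turnE sin0 cos0; ring. Qed.

Lemma turnD2pi x w : turn (x + pi *+ 2) w = turn x w.
Proof. by apply: rV2P; rewrite !turnE sinD2pi cosD2pi. Qed.

Definition sgn (b : bool) : R := if b then 1 else -1.

Lemma cos_sgnM b x : cos (sgn b * x) = cos x.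
Proof. by case: b; rewrite /sgn ?mulN1r ?mul1r ?cosN. Qed.

Lemma sin_sgnM b x : sin (sgn b * x) = sgn b * sin x.
Proof. by case: b; rewrite /sgn ?mulN1r ?mul1r ?sinN. Qed.

(** The determinant [cr] of the two vectors satisfies Lagrange's identity, so its square is sin^2 x;
    its sign is the orientation [b]. *)
Lemma unit_vectors_turn u v x : dotv u u = 1 -> dotv v v = 1 ->
  dotv u v = cos x -> exists b, v = turn (sgn b * x) u.
Proof.
rewrite !dotv2 => uu vv uv.
set cr := u 0 0 * v 0 1 - u 0 1 * v 0 0.
have cr2 : cr ^+ 2 = sin x ^+ 2.
  rewrite sin2cos2 -uv -[1]mulr1 -{1}uu -vv /cr; ring.
have [b crE] : exists b, cr = sgn b * sin x.
  move/eqP: cr2; rewrite eqf_sqr => /orP[/eqP ->|/eqP ->].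
    by exists true; rewrite /sgn mul1r.
  by exists false; rewrite /sgn mulN1r.
exists b; apply: rV2P; rewrite !turnE cos_sgnM sin_sgnM -crE -uv /cr.
  by rewrite -[LHS]mulr1 -uu; ring.
by rewrite -[LHS]mulr1 -uu; ring.
Qed.

(* A point in polar coordinates (r, z) of the sector of opening [x], in the
   oblique coordinates given by the two sides of the sector. *)
Lemma sector_point x z e r : 0 < x < pi -> 0 < z < x -> 0 < r ->
  2 * r < e * sin x ->
  exists s t, [/\ 0 < s, 0 < t, s + t < e &
    forall b y w, s *: turn y w + t *: turn (y + sgn b * x) w =
                  r *: turn (y + sgn b * z) w].
Proof.
move=> x0 /andP[z0 zx] r0 re.
have sx : 0 < sin x by apply: sin_gt0_pi.
have s1 : 0 < sin (x - z).
  by apply: sin_gt0_pi; case/andP: x0 => *; apply/andP; split; lra.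
have s2 : 0 < sin z.
  by apply: sin_gt0_pi; case/andP: x0 => *; apply/andP; split; lra.
(* Law of sines. The two coordinates add up to at most 2 r / sin x, whence the bound required of
   [e]. *)
exists (r * sin (x - z) / sin x), (r * sin z / sin x).
split; rewrite ?divr_gt0 ?mulr_gt0 //.
  rewrite -mulrDl ltr_pdivrMr // (le_lt_trans _ re) //.
  by rewrite -mulrDr mulrC ler_pM2r // (_ : 2 = 1 + 1) // lerD ?sin_le1.
move=> b y w.
rewrite (addrC y) (addrC y) !turnD; set w' := turn y w.
apply: rV2P; rewrite !mxE ?eqxx /= cos_sgnM sin_sgnM cos_sgnM sin_sgnM sinB;
  field; exact: lt0r_neq0.
Qed.

End Rotation.

(* The sectors between consecutive rays [u 0], ..., [u k] at [v] are unfolded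
   into the plane by [f], which is defined near [v] on the open sectors and on
   the inner rays. *)
Section UnfoldedSectors.
Variables (R : realType) (n k : nat) (v : 'rV[R]_n) (u : nat -> 'rV[R]_n).
Variables (x : nat -> R) (e : R) (f : 'rV[R]_n -> 'rV[R]_2).

Definition sector_pt j (s t : R) := v + s *: u j + t *: u j.+1.

(** The side [t = 0] is the ray [u j], inner when j > 0; the side [s = 0] is the ray [u j.+1], inner
    when j + 1 < k. The outer rays and the apex are left out because they may be cut. *)
Definition in_sector j (s t : R) :=
  [/\ (0 < s) || (s == 0) && (j.+1 < k)%N, (0 < t) || (t == 0) && (0 < j)%N,
      0 < s + t & s + t < e].

Hypothesis e_gt0 : 0 < e.
Hypothesis u_unit : forall j, (j <= k)%N -> dotv (u j) (u j) = 1.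
Hypothesis x_angle : forall j, (j < k)%N ->
  0 < x j < pi /\ dotv (u j) (u j.+1) = cos (x j).
Hypothesis f_iso : forall j, (j < k)%N -> forall s t s' t',
  in_sector j s t -> in_sector j s' t' ->
  edist (f (sector_pt j s t)) (f (sector_pt j s' t')) =
  edist (sector_pt j s t) (sector_pt j s' t').
Hypothesis f_inj : forall i j, (i < j < k)%N -> forall s t s' t',
  0 < s -> 0 < t -> s + t < e -> 0 < s' -> 0 < t' -> s' + t' < e ->
  f (sector_pt i s t) <> f (sector_pt j s' t').

(** The affine frame is read off at three points of the open sector at the small scale [d]; [q] is
    where the apex would go, although [f] may be unusable there. *)
Lemma sector_affine j : (j < k)%N -> exists q a b,
  (forall s t, in_sector j s t -> f (sector_pt j s t) = q + s *: a + t *: b) /\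
  [/\ dotv a a = 1, dotv b b = 1 & dotv a b = cos (x j)].
Proof.
move=> jk; set d := e / 8.
have d0 : 0 < d by rewrite divr_gt0.
have dS a b : (0 < a <= 3)%N -> (0 < b <= 3)%N ->
    in_sector j (d * a%:R) (d * b%:R).
  move=> /andP[a0 a3] /andP[b0 b3]; split; rewrite ?addr_gt0 ?mulr_gt0 ?ltr0n //.
  rewrite -mulrDr -natrD; apply: (@le_lt_trans _ _ (d * 6%:R)).
    by rewrite ler_pM2l // ler_nat (leq_add a3 b3).
  rewrite /d; move: e_gt0; lra.
pose S : set 'rV[R]_n :=
  fun y => exists s t, in_sector j s t /\ y = sector_pt j s t.
have S_iso y z : S y -> S z -> edist (f y) (f z) = edist y z.
  by move=> [s [t [st ->]]] [s' [t' [st' ->]]]; exact: f_iso.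
have dSS a b : (0 < a <= 3)%N -> (0 < b <= 3)%N ->
    S (sector_pt j (d * a%:R) (d * b%:R)).
  by move=> a3 b3; exists (d * a%:R), (d * b%:R); split => //; exact: dS.
set y0 := sector_pt j (d * 1%:R) (d * 1%:R).
set y1 := sector_pt j (d * 2%:R) (d * 1%:R).
set y2 := sector_pt j (d * 1%:R) (d * 2%:R).
have S0 : S y0 by exact: dSS.
have S1 : S y1 by exact: dSS.
have S2 : S y2 by exact: dSS.
have E1 : y1 - y0 = d *: u j.
  by apply/rowP => i; rewrite !mxE; ring.
have E2 : y2 - y0 = d *: u j.+1.
  by apply/rowP => i; rewrite !mxE; ring.
have dV (a b : R) : d^-1 * (d^-1 * (d * (d * a))) = a.
  by rewrite (mulKf (lt0r_neq0 d0)) (mulKf (lt0r_neq0 d0)).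
exists (f y0 - (f y1 - f y0) - (f y2 - f y0)).
exists (d^-1 *: (f y1 - f y0)), (d^-1 *: (f y2 - f y0)); split; last first.
  have [_ xj] := x_angle jk.
  split; rewrite dotvZl dotvZr (isometry_dot S_iso) // ?E1 ?E2 dotvZl dotvZr dV //.
  - exact/u_unit/ltnW.
  - exact: u_unit.
move=> s t st.
have Sst : S (sector_pt j s t) by exists s, t.
have := isometry_affine S_iso (s := (s - d) / d) (t := (t - d) / d) S0 S1 S2 Sst.
rewrite E1 E2 => /(_ _) h.
have -> : f (sector_pt j s t) = f (sector_pt j s t) - f y0 + f y0.
  by rewrite subrK.
rewrite h; last first.
  by apply/rowP => i; rewrite !mxE; field; exact: lt0r_neq0.
by apply/rowP => i; rewrite !mxE; field; exact: lt0r_neq0.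
Qed.

Definition partial_angle j := \sum_(i < j) x i.

Lemma partial_angleS j : partial_angle j.+1 = partial_angle j + x j.
Proof. by rewrite /partial_angle big_ord_recr. Qed.

(* All the turns have the same orientation: two consecutive sectors turning in
   opposite directions would overlap near their common ray. *)
Lemma unfolded_sectors m : (0 < m <= k)%N -> exists b q w, dotv w w = 1 /\
  forall j, (j < m)%N -> forall s t, in_sector j s t ->
  f (sector_pt j s t) = q + s *: turn (sgn R b * partial_angle j) w
                          + t *: turn (sgn R b * partial_angle j.+1) w.
Proof.
elim: m => // -[_ /= k0|m IH /= mk].
  have [q [a [c [fE [aa cc ac]]]]] := sector_affine k0.
  have [b cE] := unit_vectors_turn aa cc ac.
  exists b, q, a; split => // -[|//] _ s t st.
  by rewrite fE // /partial_angle big_ord0 mulr0 turn0 big_ord1 cE.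
have e0 := e_gt0.
have [b [q [w [ww fE]]]] := IH (ltnW mk).
have [q' [a [c [fE' [aa cc ac]]]]] := sector_affine mk.
(* The inner ray [u m.+1] belongs to both neighbouring sectors, so their two affine formulas agree
   on it; comparing at e / 2 and e / 4 identifies first the direction, then the apex. *)
have fw (s : R) : 0 < s -> s < e ->
    q + s *: turn (sgn R b * partial_angle m.+1) w = q' + s *: a.
  move=> s0 se.
  have := fE m (ltnSn _) 0 s; rewrite scale0r addr0 => <-; last first.
    by split; rewrite ?eqxx ?s0 ?add0r ?mk ?orbT.
  have := fE' s 0; rewrite scale0r addr0 => <-.
    by congr f; rewrite /sector_pt !scale0r !addr0.
  by split; rewrite ?eqxx ?s0 ?addr0 ?orbT.
have aE : a = turn (sgn R b * partial_angle m.+1) w.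
  have e4 : 0 < e / 4 by lra.
  have h2 := fw (e / 2) ltac:(lra) ltac:(lra).
  have h4 := fw (e / 4) ltac:(lra) ltac:(lra).
  apply/rowP => i; apply: (mulfI (lt0r_neq0 e4)).
  have := congr1 (fun y : 'rV[R]_2 => y 0 i) h2.
  have := congr1 (fun y : 'rV[R]_2 => y 0 i) h4.
  by rewrite !mxE; lra.
have qE : q' = q.
  by have := fw (e / 2) ltac:(lra) ltac:(lra); rewrite -aE => /addIr.
have [b' cE] := unit_vectors_turn aa cc ac.
have [bb'|bb'] := eqVneq b b'.
  exists b, q, w; split => // j; rewrite ltnS leq_eqVlt => /orP[/eqP ->|]; last first.
    exact: fE.
  move=> s t st; rewrite fE' // cE aE qE -turnD -bb' -mulrDr.
  by rewrite (partial_angleS m.+1) (addrC (x _)).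
exfalso.
have mk' : (m < k)%N by exact: ltnW.
have [x1 _] := x_angle mk'.
have [x2 _] := x_angle mk.
have s1 := sin_gt0_pi x1; have s2 := sin_gt0_pi x2.
(* If the orientations differ, the direction at angle [z] from the common ray lies in both images,
   and [r] is small enough for [sector_point] in either sector. *)
pose z := Num.min (x m) (x m.+1) / 2.
have z0 : 0 < z by rewrite divr_gt0 // lt_min; case/andP: x1 => ->; case/andP: x2 => ->.
have zm : z < x m.
  case/andP: x1 => p1 _; rewrite /z; case: (leP (x m) (x m.+1)) => h; lra.
have zm1 : z < x m.+1.
  case/andP: x2 => p1 _; rewrite /z; case: (leP (x m) (x m.+1)) => h; lra.
pose r := e * sin (x m) * sin (x m.+1) / 4.
have r0 : 0 < r by rewrite divr_gt0 ?mulr_gt0.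
have rle (a1 a2 : R) : 0 < a1 -> 0 < a2 -> a2 <= 1 -> 2 * (e * a1 * a2 / 4) < e * a1.
  move=> a10 a20 a21; have p : 0 < e * a1 by rewrite mulr_gt0.
  have : e * a1 * a2 <= e * a1 by rewrite ger_pMr.
  lra.
have [] := @sector_point R (x m) (x m - z) e r x1 _ r0 _.
- lra.
- by apply: rle => //; exact: sin_le1.
move=> s [t [s0 t0 st ptE]].
have [] := @sector_point R (x m.+1) z e r x2 _ r0 _.
- lra.
- by rewrite /r (mulrAC e); apply: rle => //; exact: sin_le1.
move=> s' [t' [s0' t0' st' ptE']].
apply: (@f_inj m m.+1 _ s t s' t') => //; first by rewrite ltnSn.
rewrite fE //; last by split; rewrite ?s0 ?t0 ?addr_gt0.
rewrite fE' //; last by split; rewrite ?s0' ?t0' ?addr_gt0.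
rewrite qE cE aE -turnD (addrC _ (sgn R b * _)) -!addrA ptE'.
rewrite (partial_angleS m) mulrDr ptE.
congr (_ + _ *: turn _ _).
by case: (b) (b') bb' => [] [] // _; rewrite /sgn; ring.
Qed.

(** Otherwise the first sector that passes 2 pi comes back over sector 0, against injectivity. It is
    not sector 0 itself, whose opening is below pi. *)
Lemma unfolded_sectors_narrow : \sum_(i < k) x i <= pi *+ 2.
Proof.
rewrite leNgt; apply/negP => wide.
have e0 := e_gt0; have pi0 := pi_gt0 R.
have k0 : (0 < k)%N.
  by rewrite lt0n; apply: contraTneq wide => ->; rewrite big_ord0 -leNgt mulrn_wge0 ?ltW.
have [b [q [w [ww fE]]]] := @unfolded_sectors k ltac:(by rewrite k0 leqnn).
have ex : exists j, pi *+ 2 < partial_angle j.+1 by exists k.-1; rewrite prednK.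
case: (ex_minnP ex) => j j2 jmin.
have jk : (j < k)%N.
  by rewrite -(prednK k0) ltnS; apply: jmin; rewrite prednK.
have [x0 _] := x_angle k0.
have [xj _] := x_angle jk.
have S0 : partial_angle 0 = 0 by rewrite /partial_angle big_ord0.
have j0 : (0 < j)%N.
  rewrite lt0n; apply/eqP => j0; move: j2; rewrite j0 partial_angleS S0.
  by case/andP: x0; lra.
have jle : partial_angle j <= pi *+ 2.
  rewrite leNgt; apply/negP => h.
  by have := jmin j.-1; rewrite (prednK j0) => /(_ h); rewrite -ltnS (prednK j0) ltnn.
(* The direction [z] is inside sector 0, and 2 pi + z, the same direction in the plane, is inside
   sector [j]. *)
pose z := Num.min (x 0%N) (partial_angle j.+1 - pi *+ 2) / 2.
have [z0 zx zj] : [/\ 0 < z, z < x 0%N & z < partial_angle j.+1 - pi *+ 2].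
  by case/andP: x0 => p0 p1; rewrite /z; split; case: (leP (x 0%N) (partial_angle j.+1 - pi *+ 2)) => h; move: j2; lra.
have s1 := sin_gt0_pi x0; have s2 := sin_gt0_pi xj.
pose r := e * sin (x 0%N) * sin (x j) / 4.
have r0 : 0 < r by rewrite divr_gt0 ?mulr_gt0.
have rle (a1 a2 : R) : 0 < a1 -> 0 < a2 -> a2 <= 1 -> 2 * (e * a1 * a2 / 4) < e * a1.
  move=> a10 a20 a21; have p : 0 < e * a1 by rewrite mulr_gt0.
  have : e * a1 * a2 <= e * a1 by rewrite ger_pMr.
  lra.
have [] := @sector_point R (x 0%N) z e r x0 _ r0 _.
- lra.
- by apply: rle => //; exact: sin_le1.
move=> s [t [s0 t0 st ptE]].
have [] := @sector_point R (x j) (pi *+ 2 + z - partial_angle j) e r xj _ r0 _.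
- by move: zj; rewrite partial_angleS; lra.
- by rewrite /r (mulrAC e); apply: rle => //; exact: sin_le1.
move=> s' [t' [s0' t0' st' ptE']].
apply: (@f_inj 0 j _ s t s' t') => //; first by rewrite j0.
rewrite fE //; last by split; rewrite ?s0 ?t0 ?addr_gt0.
rewrite fE //; last by split; rewrite ?s0' ?t0' ?addr_gt0.
rewrite -!addrA !partial_angleS !mulrDr ptE ptE' S0 mulr0 add0r.
congr (_ + _ *: _).
rewrite -mulrDr addrC subrK.
case: (b); rewrite /sgn ?mul1r ?mulN1r; first by rewrite addrC turnD2pi.
by rewrite -[RHS]turnD2pi opprD addrAC addNr add0r.
Qed.

End UnfoldedSectors.

(** * Convex faces of a polyhedron and where cuts can run *)

Section Faces.
Variable R : realType.
Implicit Types (F G : face R) (P : seq (face R)) (x v w a b c : 'rV[R]_3).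
Implicit Types (e : 'rV[R]_3 * 'rV[R]_3) (E : seq ('rV[R]_3 * 'rV[R]_3)).

(** Adding indicator weights lets [a], [b], [c] coincide, so that segments are covered as well as
    triangles. *)
Lemma region_comb F a b c (r s t : R) : a \in F -> b \in F -> c \in F ->
  0 <= r -> 0 <= s -> 0 <= t -> r + s + t = 1 ->
  region F (r *: a + s *: b + t *: c).
Proof.
move=> aF bF cF r0 s0 t0 rst.
pose i a (aF : a \in F) := Ordinal (etrans (index_mem a F) aF).
pose w k (k' : 'I_(size F)) : R := if k' == k then 1 else 0.
have sumw (T : lmodType R) k (g : 'I_(size F) -> T) : \sum_j w k j *: g j = g k.
  rewrite (bigD1 k) //= /w eqxx scale1r big1 ?addr0 // => j /negPf ->.
  by rewrite scale0r.
have sumw1 k : \sum_j w k j = 1.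
  by rewrite -[RHS](sumw R^o k (fun=> 1)); apply: eq_bigr => j _; rewrite /GRing.scale /= mulr1.
have w0 k j : 0 <= w k j by rewrite /w; case: ifP.
exists (fun j => r * w (i _ aF) j + s * w (i _ bF) j + t * w (i _ cF) j).
split; first by move=> j; rewrite !addr_ge0 ?mulr_ge0.
split; first by rewrite !big_split -!mulr_sumr !sumw1 !mulr1.
under eq_bigr => j _ do rewrite !scalerDl -!scalerA.
by rewrite !big_split -!scaler_sumr !sumw /= !nth_index.
Qed.

Lemma edgesP F e : reflect
  (exists2 i, (i < size F)%N & e = (F`_i, F`_(i.+1 %% size F))) (e \in edges F).
Proof.
apply: (iffP mapP) => -[i]; rewrite ?mem_iota => iF ->; exists i => //.
by rewrite mem_iota.
Qed.

Lemma edges_mem F e : e \in edges F -> e.1 \in F /\ e.2 \in F.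
Proof.
by case/edgesP=> i iF -> /=; rewrite !mem_nth // ltn_pmod // (leq_ltn_trans _ iF).
Qed.

Lemma edges_neq F e : uniq F -> (1 < size F)%N -> e \in edges F -> e.1 != e.2.
Proof.
move=> uF F1 /edgesP[i iF -> /=].
have F0 : (0 < size F)%N by exact: ltnW.
rewrite nth_uniq ?ltn_pmod //.
move: iF; rewrite leq_eqVlt => /orP[/eqP|] iF; last by rewrite modn_small ?neq_ltn ?ltnSn.
by rewrite iF modnn -lt0n -ltnS iF.
Qed.

Lemma vertex_edge F v : v \in F -> exists2 e, e \in edges F & e.1 = v.
Proof.
move=> vF; exists (v, F`_((index v F).+1 %% size F)) => //.
by apply/edgesP; exists (index v F); rewrite ?index_mem ?nth_index.
Qed.

Lemma same_edgexx e : same_edge e e.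
Proof. by rewrite /same_edge !eqxx. Qed.

Lemma same_edgeP e e' :
  reflect (e = e' \/ e = (e'.2, e'.1)) (same_edge e e').
Proof.
case: e e' => a b [c d]; rewrite /same_edge /=.
by apply: (iffP orP) => -[|] h; [left|right|left|right];
   move: h; [case/andP=> /eqP -> /eqP ->|case/andP=> /eqP -> /eqP ->
            |case=> -> ->; rewrite !eqxx|case=> -> ->; rewrite !eqxx].
Qed.

Lemma same_edge_sym e e' : same_edge e e' = same_edge e' e.
Proof.
case: e e' => a b [c d]; rewrite /same_edge /=.
by rewrite !(eq_sym c) !(eq_sym d) [X in _ || X]andbC.
Qed.

Lemma same_edge_trans e1 e2 e3 :
  same_edge e1 e2 -> same_edge e2 e3 -> same_edge e1 e3.
Proof.
move=> /same_edgeP h1 /same_edgeP h2; apply/same_edgeP.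
by case: e1 e2 e3 h1 h2 => a b [c d] [f g] /= [] [-> ->] [] [-> ->]; [left|right|right|left].
Qed.

Lemma segmentC n (a b x : 'rV[R]_n) : segment a b x -> segment b a x.
Proof.
move=> [t [/andP[t0 t1] ->]]; exists (1 - t); split.
  by apply/andP; split; lra.
by rewrite subKr addrC.
Qed.

Lemma same_edge_segment e e' x :
  same_edge e e' -> segment e.1 e.2 x -> segment e'.1 e'.2 x.
Proof. by move=> /same_edgeP[->|->] //= /segmentC. Qed.

Lemma is_edge_ofP F e :
  reflect (exists2 e', e' \in edges F & same_edge e e') (is_edge_of F e).
Proof. exact: hasP. Qed.

Lemma is_edge_of_same F e e' : same_edge e e' -> is_edge_of F e -> is_edge_of F e'.
Proof.
rewrite same_edge_sym => ee' /is_edge_ofP[d dF ed].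
by apply/is_edge_ofP; exists d => //; apply: same_edge_trans ed.
Qed.

Lemma is_edge_of_mem F e : is_edge_of F e -> e.1 \in F /\ e.2 \in F.
Proof.
by move=> /is_edge_ofP[d /edges_mem[d1 d2] /same_edgeP[->|->]].
Qed.

Lemma is_edge_of_neq F e : uniq F -> (1 < size F)%N -> is_edge_of F e -> e.1 != e.2.
Proof.
move=> uF F1 /is_edge_ofP[d /(edges_neq uF F1) dd /same_edgeP[->|->]] //=.
by rewrite eq_sym.
Qed.

Lemma segment_region F e x : is_edge_of F e -> segment e.1 e.2 x -> region F x.
Proof.
move=> /is_edge_of_mem[e1 e2] [t [/andP[t0 t1] ->]].
rewrite -[_ + _]addr0 -(scale0r e.1).
by apply: region_comb => //; lra.
Qed.

(** Each side is the set where a linear functional of the ambient space is minimal on the face, and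
    only its two ends are minimal vertices. This avoids coordinates in the plane of the face. *)
Definition strictly_convex F := forall e, e \in edges F ->
  exists nv d, [/\ dotv nv e.1 = d, dotv nv e.2 = d &
    forall w, w \in F -> w != e.1 -> w != e.2 -> d < dotv nv w].

Definition convex_face F := [/\ (2 < size F)%N, uniq F & strictly_convex F].

Lemma convex_face_support F e : convex_face F -> is_edge_of F e ->
  exists nv d, [/\ dotv nv e.1 = d, dotv nv e.2 = d &
    forall w, w \in F -> w != e.1 -> w != e.2 -> d < dotv nv w].
Proof.
move=> [_ _ scF] /is_edge_ofP[d dF] /same_edgeP[->|->]; first exact: scF.
have [nv [c [h1 h2 h3]]] := scF _ dF; exists nv, c; split => // w wF w1 w2.
exact: h3.
Qed.

Lemma convex_face_edge_neq F e : convex_face F -> is_edge_of F e -> e.1 != e.2.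
Proof. by move=> [F2 uF _]; apply: is_edge_of_neq => //; exact: ltnW. Qed.

(** The functional supporting [e] is minimal at [x]. As [x] is interior to [e'] too, both ends of
    [e'] are minimal, hence are the ends of [e]. *)
Lemma convex_face_same_edge F e e' x (t : R) : convex_face F ->
  is_edge_of F e -> is_edge_of F e' -> 0 < t < 1 ->
  x = (1 - t) *: e.1 + t *: e.2 -> segment e'.1 e'.2 x -> same_edge e e'.
Proof.
move=> cF eF e'F /andP[t0 t1] xE [s [/andP[s0 s1] xE']].
have [nv [d [h1 h2 h3]]] := convex_face_support cF eF.
have ee := convex_face_edge_neq cF eF.
have ee' := convex_face_edge_neq cF e'F.
have [e1F e2F] := is_edge_of_mem e'F.
have hx : dotv nv x = d by rewrite xE !dotvE h1 h2; ring.
have xe1 : x != e.1.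
  apply: contra_neq ee => /eqP; rewrite xE -subr_eq0 => /eqP h.
  have {h} : t *: (e.2 - e.1) = 0 by rewrite -h; apply/rowP => i; rewrite !mxE; ring.
  by move=> /eqP; rewrite scaler_eq0 (gt_eqF t0) /= subr_eq0 => /eqP.
have xe2 : x != e.2.
  apply: contra_neq ee => /eqP; rewrite xE -subr_eq0 => /eqP h.
  have {h} : (1 - t) *: (e.1 - e.2) = 0 by rewrite -h; apply/rowP => i; rewrite !mxE; ring.
  by move=> /eqP; rewrite scaler_eq0 subr_eq0 (gt_eqF t1) /= subr_eq0 => /eqP.
have on w : w \in F -> (w == e.1) || (w == e.2) || (d < dotv nv w).
  by move=> wF; case: eqVneq => //= w1; case: eqVneq => //= w2; exact: h3.
have hd w : w \in F -> d <= dotv nv w.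
  by move=> /on /orP[/orP[/eqP ->|/eqP ->]|/ltW //]; rewrite ?h1 ?h2.
have end1 w : x = w -> w \in F -> False.
  move=> xw wF; have := on w wF; rewrite -xw (negPf xe1) (negPf xe2) /=.
  by rewrite hx ltxx.
have hs : (1 - s) * dotv nv e'.1 + s * dotv nv e'.2 = d by rewrite -hx xE' !dotvE.
have s0' : 0 < s.
  rewrite lt_def s0 andbT; apply/eqP => s00; apply: (end1 e'.1) => //.
  by rewrite xE' s00 subr0 scale1r scale0r addr0.
have s1' : 0 < 1 - s.
  rewrite lt_def subr_ge0 s1 andbT; apply/eqP => s00; apply: (end1 e'.2) => //.
  by rewrite xE' s00 scale0r add0r (_ : s = 1) ?scale1r //; lra.
have k1 : 0 <= (1 - s) * (dotv nv e'.1 - d).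
  by rewrite mulr_ge0 ?(ltW s1') // subr_ge0 hd.
have k2 : 0 <= s * (dotv nv e'.2 - d) by rewrite mulr_ge0 // subr_ge0 hd.
have k12 : (1 - s) * (dotv nv e'.1 - d) + s * (dotv nv e'.2 - d) = 0.
  by rewrite -[RHS](subrr d) -{3}hs; ring.
have z1 : dotv nv e'.1 = d.
  apply/eqP; rewrite -subr_eq0 -(mulrI_eq0 _ (mulfI (lt0r_neq0 s1'))); apply/eqP.
  lra.
have z2 : dotv nv e'.2 = d.
  apply/eqP; rewrite -subr_eq0 -(mulrI_eq0 _ (mulfI (lt0r_neq0 s0'))); apply/eqP.
  lra.
have := on _ e1F; have := on _ e2F; rewrite z1 z2 ltxx !orbF.
rewrite same_edge_sym /same_edge.
move=> /orP[] /eqP p2 /orP[] /eqP p1; move: ee'; rewrite p1 p2 ?eqxx ?orbT //.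
Qed.

(** On [e] the supporting functional is minimal, so a positive combination there would make three
    distinct vertices minimal, and only the two ends of [e] are. *)
Lemma convex_face_open F e v a b (r s t : R) : convex_face F -> is_edge_of F e ->
  v \in F -> a \in F -> b \in F -> uniq [:: v; a; b] ->
  0 < r -> 0 < s -> 0 < t ->
  r + s + t = 1 -> ~ segment e.1 e.2 (r *: v + s *: a + t *: b).
Proof.
move=> cF eF vF aF bF uvab r0 s0 t0 rst [z [/andP[z0 z1] xE]].
have [nv [d [h1 h2 h3]]] := convex_face_support cF eF.
have hd w : w \in F -> d <= dotv nv w.
  move=> wF; have [->|w1] := eqVneq w e.1; first by rewrite h1.
  have [->|w2] := eqVneq w e.2; first by rewrite h2.
  exact/ltW/h3.
have := congr1 (dotv nv) xE; rewrite !dotvE h1 h2 => hE.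
have hz (c : R) w : 0 < c -> w \in F -> 0 <= c * (dotv nv w - d).
  by move=> c0 wF; rewrite mulr_ge0 ?(ltW c0) // subr_ge0 hd.
have sum0 : r * (dotv nv v - d) + s * (dotv nv a - d) + t * (dotv nv b - d) = 0.
  rewrite [LHS](_ : _ = r * dotv nv v + s * dotv nv a + t * dotv nv b - (r + s + t) * d).
    by rewrite hE rst; ring.
  by ring.
have pv := hz _ _ r0 vF; have pa := hz _ _ s0 aF; have pb := hz _ _ t0 bF.
have endp (c : R) w : 0 < c -> w \in F -> c * (dotv nv w - d) = 0 -> w \in [:: e.1; e.2].
  move=> c0 wF /eqP; rewrite mulf_eq0 (gt_eqF c0) subr_eq0 /= => /eqP hw.
  rewrite !inE; case: eqVneq => //= w1; case: eqVneq => //= w2.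
  by have := h3 w wF w1 w2; rewrite hw ltxx.
have sub : {subset [:: v; a; b] <= [:: e.1; e.2]}.
  move=> w; rewrite 3!in_cons in_nil orbF => /or3P[] /eqP ->.
  - by apply: endp r0 vF _; lra.
  - by apply: endp s0 aF _; lra.
  - by apply: endp t0 bF _; lra.
by have := uniq_leq_size uvab sub.
Qed.

Section Polyhedron.
Variable P : seq (face R).
Hypothesis P_poly : polyhedron P.

Lemma polyhedron_meet F G x : F \in P -> G \in P -> F != G ->
  region F x -> region G x -> common_part F G x.
Proof.
move=> /(nthP [::])[i iP <-] /(nthP [::])[j jP <-] ij Fx Gx.
have [_ h _ _] := P_poly; rewrite -h //; apply: contra_neq ij => ->; by [].
Qed.

Hypothesis P_convex : forall F, F \in P -> convex_face F.

(** Two faces meet in vertices and edges of [F] only, and [convex_face_open] keeps the point off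
    every edge, hence off every vertex. *)
Lemma open_face_meet F G v a b (r s t : R) : F \in P -> G \in P -> F != G ->
  v \in F -> a \in F -> b \in F -> uniq [:: v; a; b] ->
  0 < r -> 0 < s -> 0 < t -> r + s + t = 1 ->
  ~ region G (r *: v + s *: a + t *: b).
Proof.
move=> FP GP FG vF aF bF uvab r0 s0 t0 rst Gx.
have Fx : region F (r *: v + s *: a + t *: b) by apply: region_comb; rewrite ?ltW.
have noseg e : e \in edges F -> ~ segment e.1 e.2 (r *: v + s *: a + t *: b).
  move=> eF; apply: (convex_face_open (P_convex FP)) => //.
  by apply/is_edge_ofP; exists e; rewrite ?same_edgexx.
have [[w [wF wG xE]]|[e [eF eG]]] := polyhedron_meet FP GP FG Fx Gx; last exact: noseg.
have [e eF ew] := vertex_edge wF; apply: (noseg e eF).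
exists 0; split; first by rewrite lexx ler01.
by rewrite xE ew subr0 scale1r scale0r addr0.
Qed.

Section Cut.
Variable E : seq ('rV[R]_3 * 'rV[R]_3).
Hypothesis E_edges : forall e, e \in E -> exists2 F, F \in P & is_edge_of F e.

Lemma open_face_uncut F v a b (r s t : R) : F \in P ->
  v \in F -> a \in F -> b \in F -> uniq [:: v; a; b] ->
  0 < r -> 0 < s -> 0 < t -> r + s + t = 1 ->
  ~ cutset E (r *: v + s *: a + t *: b).
Proof.
move=> FP vF aF bF uvab r0 s0 t0 rst [e eE xe].
have [G GP eG] := E_edges eE.
have [FG|FG] := eqVneq F G.
  by rewrite -FG in eG; apply: (convex_face_open (P_convex FP) eG _ _ _ uvab) xe.
apply: (open_face_meet FP GP FG vF aF bF uvab r0 s0 t0 rst).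
exact: segment_region xe.
Qed.

(** A cut through the point is an edge of some face [G]. The point is no vertex of [F], so it lies
    on an edge common to [F] and [G], which must be [e]; within [G] the cut is then [e] itself. *)
Lemma open_edge_uncut F e (t : R) : F \in P -> is_edge_of F e -> 0 < t < 1 ->
  ~~ has (same_edge e) E -> ~ cutset E ((1 - t) *: e.1 + t *: e.2).
Proof.
move=> FP eF t01 uncut [e' e'E xe'].
set x := (1 - t) *: e.1 + t *: e.2 in xe'.
have [G GP e'G] := E_edges e'E.
suff eG : is_edge_of G e.
  move/hasPn: uncut => /(_ _ e'E)/negP; apply.
  exact: convex_face_same_edge (P_convex GP) eG e'G t01 (erefl _) xe'.
have [<- //|FG] := eqVneq F G.
have Gx : region G x by exact: segment_region xe'.
have Fx : region F x.
  apply: (segment_region eF); exists t; split => //.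
  by case/andP: t01 => /ltW -> /ltW ->.
have [[w [wF wG xE]]|[d [dF dG xd]]] := polyhedron_meet FP GP FG Fx Gx; last first.
  apply: is_edge_of_same dG; rewrite same_edge_sym.
  apply: convex_face_same_edge (P_convex FP) eF _ t01 (erefl _) xd.
  by apply/is_edge_ofP; exists d; rewrite ?same_edgexx.
have [F2 uF _] := P_convex FP.
exfalso.
have [d dF dw] := vertex_edge wF.
have dF' : is_edge_of F d by apply/is_edge_ofP; exists d; rewrite ?same_edgexx.
have xd : segment d.1 d.2 x.
  exists 0; split; first by rewrite lexx ler01.
  by rewrite xE dw subr0 scale1r scale0r addr0.
have := convex_face_same_edge (P_convex FP) eF dF' t01 (erefl _) xd.
have ee := convex_face_edge_neq (P_convex FP) eF.
case/andP: t01 => t0 t1.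
move=> /same_edgeP de.
have {}dw : w = e.1 \/ w = e.2 by rewrite -dw; case: de => ->; [left|right].
case: dw xE => -> /eqP; rewrite -subr_eq0 => /eqP h; move/negP: ee; apply.
  have {h} : t *: (e.2 - e.1) = 0 by rewrite -h; apply/rowP => i; rewrite !mxE; ring.
  by move=> /eqP; rewrite scaler_eq0 (gt_eqF t0) /= subr_eq0 => /eqP ->.
have {h} : (1 - t) *: (e.1 - e.2) = 0 by rewrite -h; apply/rowP => i; rewrite !mxE; ring.
by move=> /eqP; rewrite scaler_eq0 subr_eq0 (gt_eqF t1) /= subr_eq0.
Qed.

End Cut.
End Polyhedron.
End Faces.

(** * Unfolding forces cuts around a vertex *)

Section CutsAroundVertex.
Variables (R : realType) (P : seq (face R)) (E : seq ('rV[R]_3 * 'rV[R]_3)).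
Hypothesis P_poly : polyhedron P.
Hypothesis P_convex : forall F, F \in P -> convex_face F.

Variables (k : nat) (v : 'rV[R]_3) (A : nat -> 'rV[R]_3).
Variables (F : nat -> face R) (x : nat -> R).
Hypothesis FP : forall j, (j < k)%N -> F j \in P.
Hypothesis F_uniq : forall i j, (i < j < k)%N -> F i != F j.
Hypothesis vF : forall j, (j < k)%N -> v \in F j.
Hypothesis AF : forall j, (j < k)%N -> A j \in F j /\ A j.+1 \in F j.
Hypothesis x_angle : forall j, (j < k)%N ->
  has_angle (A j - v) (A j.+1 - v) (x j).
Hypothesis inner_edge : forall j, (0 < j < k)%N -> is_edge_of (F j) (v, A j).

(** With all inner edges uncut, the faces near [v] are sectors to which [unfolded_sectors_narrow]
    applies. *)
Lemma wide_angle_cut : edge_unfolding P E -> pi *+ 2 < \sum_(j < k) x j ->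
  exists2 j, (0 < j < k)%N & has (same_edge (v, A j)) E.
Proof.
move=> [E_edges _ _ [f [f_inj f_iso]]] wide; apply: contrapT => nocut.
have k0 : (0 < k)%N.
  rewrite lt0n; apply: contraTneq wide => ->.
  by rewrite big_ord0 -leNgt mulrn_wge0 // pi_ge0.
have A0 j : (j <= k)%N -> A j - v != 0.
  rewrite leq_eqVlt => /orP[/eqP ->|/x_angle[] //].
  by have [|_ + _ _] := @x_angle k.-1; rewrite ?prednK.
have Av j : (j <= k)%N -> A j != v by move/A0; rewrite subr_eq0.
have AA j : (j < k)%N -> A j != A j.+1.
  move=> jk; apply: contraTneq (has_angle_gram (x_angle jk)) => ->.
  by rewrite /gram -expr2 subrr ltxx.
pose u j := (enorm (A j - v))^-1 *: (A j - v).
(* With [e] below all edge lengths at [v], the condition s + t < e keeps the barycentric coefficient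
   of [v] positive, so sector points are genuine face points. *)
have [e e0 eA] : exists2 e, 0 < e & forall j, (j <= k)%N -> e <= enorm (A j - v).
  elim: (k) A0 => [|m IH] A0.
    by exists (enorm (A 0%N - v)); [exact/enorm_gt0/A0|case].
  have [e e0 eA] := IH (fun j jm => A0 j (leqW jm)).
  exists (Num.min e (enorm (A m.+1 - v))); first by rewrite lt_min e0 enorm_gt0 ?A0.
  move=> j; rewrite leq_eqVlt => /orP[/eqP ->|]; rewrite ge_min ?lexx ?orbT //.
  by rewrite ltnS => /eA ->.
pose s' j (s : R) := s / enorm (A j - v).
have ptE j s t : (j < k)%N -> sector_pt v u j s t =
    (1 - s' j s - s' j.+1 t) *: v + s' j s *: A j + s' j.+1 t *: A j.+1.
  by move=> jk; apply/rowP => i; rewrite !mxE /s'; ring.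
have s'_ge0 j s : (j <= k)%N -> 0 <= s -> 0 <= s' j s.
  by move=> jk s0; rewrite divr_ge0 ?enorm_ge0.
have s'_gt0 j s : (j <= k)%N -> 0 < s -> 0 < s' j s.
  by move=> jk s0; rewrite divr_gt0 ?enorm_gt0 ?A0.
have r_gt0 j s t : (j < k)%N -> 0 <= s -> 0 <= t -> s + t < e ->
    0 < 1 - s' j s - s' j.+1 t.
  move=> jk s0 t0 st.
  have le i (z : R) : (i <= k)%N -> 0 <= z -> s' i z <= z / e.
    move=> ik z0; rewrite ler_wpM2l // lef_pV2 ?posrE ?enorm_gt0 ?A0 //.
    exact: eA.
  have := le j s (ltnW jk) s0; have := le j.+1 t jk t0.
  have : (s + t) / e < 1 by rewrite ltr_pdivrMr // mul1r.
  rewrite mulrDl; lra.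
have unitE j : (j <= k)%N -> dotv (u j) (u j) = 1.
  move=> jk; rewrite dotvZl dotvZr -enorm_sqr; field; exact/lt0r_neq0/enorm_gt0/A0.
have uniq_vAA j : (j < k)%N -> uniq [:: v; A j; A j.+1].
  by move=> jk; rewrite /= !inE !(eq_sym v) !(negPf (Av _ _)) ?AA // ltnW.
(* Open sectors avoid the cuts by [open_face_uncut], inner rays by [open_edge_uncut] and the
   assumption [nocut]. *)
have dom j s t : (j < k)%N -> in_sector k e j s t ->
    region (F j) (sector_pt v u j s t) /\ ~ cutset E (sector_pt v u j s t).
  move=> jk [s0 t0 st0 ste].
  have ge0 (z : R) (b : bool) : (0 < z) || (z == 0) && b -> 0 <= z.
    by case/orP => [/ltW //|/andP[/eqP ->]].
  have [Aj AjS] := AF jk.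
  have s0' := ge0 _ _ s0; have t0' := ge0 _ _ t0.
  split.
    rewrite ptE //; apply: region_comb => //; first exact: vF.
    - exact/ltW/r_gt0.
    - by apply: s'_ge0 => //; exact: ltnW.
    - exact: s'_ge0.
    - by ring.
  have r0 := r_gt0 j s t jk (ge0 _ _ s0) (ge0 _ _ t0) ste.
  case/orP: s0 => [s0|/andP[/eqP s0 j1]]; last first.
    have t1 : 0 < t by move: st0; rewrite s0 add0r.
    rewrite ptE // s0 /s' mul0r subr0 scale0r addr0 -/(s' j.+1 t).
    have := @open_edge_uncut _ _ P_poly P_convex E E_edges (F j.+1) (v, A j.+1) (s' j.+1 t).
    apply => //; [exact: FP|exact: inner_edge| |].
      by rewrite s'_gt0 //=; move: r0; rewrite s0 /s' mul0r subr0 subr_gt0.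
    by apply/negP => cut; apply: nocut; exists j.+1.
  case/orP: t0 => [t0|/andP[/eqP t0 j1]]; last first.
    rewrite ptE // t0 /s' mul0r subr0 scale0r addr0 -/(s' j s).
    have := @open_edge_uncut _ _ P_poly P_convex E E_edges (F j) (v, A j) (s' j s).
    apply => //; [exact: FP|by apply: inner_edge; rewrite j1| |].
      by rewrite s'_gt0 1?ltnW //=; move: r0; rewrite t0 /s' mul0r subr0 subr_gt0.
    by apply/negP => cut; apply: nocut; exists j; rewrite // j1.
  rewrite ptE //.
  apply: (open_face_uncut P_poly P_convex E_edges (FP jk)) => //; first exact: vF.
  - exact: uniq_vAA.
  - by apply: s'_gt0 => //; exact: ltnW.
  - exact: s'_gt0.
  - by ring.
suff : \sum_(j < k) x j <= pi *+ 2 by rewrite leNgt wide.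
apply: (@unfolded_sectors_narrow R 3 k v u x e f e0 unitE).
- move=> j jk; have [Aj0 AS0 xj dE] := x_angle jk; split => //.
  rewrite dotvZl dotvZr dE; field.
  by rewrite !lt0r_neq0 ?enorm_gt0.
- move=> j jk s t s1 t1 st st1.
  have [h1 h2] := dom _ _ _ jk st; have [h3 h4] := dom _ _ _ jk st1.
  by apply: (f_iso (F j)); rewrite ?FP.
move=> i j /andP[ij jk] s t s1 t1 s0 t0 st s10 t10 st1 fE.
have ik : (i < k)%N by exact: ltn_trans jk.
have [h1 h2] : region (F i) (sector_pt v u i s t) /\ ~ cutset E (sector_pt v u i s t).
  by apply: dom => //; split; rewrite ?s0 ?t0 ?addr_gt0.
have [h3 h4] : region (F j) (sector_pt v u j s1 t1) /\ ~ cutset E (sector_pt v u j s1 t1).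
  by apply: dom => //; split; rewrite ?s10 ?t10 ?addr_gt0.
have ptEQ : sector_pt v u i s t = sector_pt v u j s1 t1.
  apply: f_inj fE; split => //; [exists (F i)|exists (F j)] => //; exact: FP.
have [Ai AiS] := AF ik.
have FFij : F i != F j by apply: F_uniq; rewrite ij.
have := open_face_meet P_poly P_convex (FP ik) (FP jk) FFij (vF ik) Ai AiS
  (uniq_vAA i ik) (r_gt0 i s t ik (ltW s0) (ltW t0) st)
  (s'_gt0 i s (ltnW ik) s0) (s'_gt0 i.+1 t ik t0).
rewrite -ptE // ptEQ; apply => //; by ring.
Qed.

End CutsAroundVertex.

(** * Cuts that disconnect the surface *)

Section Separation.
Variable R : realType.
Implicit Types (F G : face R) (P : seq (face R)).
Local Open Scope classical_set_scope.

(** The region is the continuous image of a compact set of weights, the unit cube intersected with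
    the closed hyperplane of sum 1. *)
Lemma region_closed F : closed (region F).
Proof.
apply: compact_closed; first exact: norm_hausdorff.
set n := size F.
pose g (w : 'rV[R]_n) : 'rV[R]_3 := \sum_(i < n) w ord0 i *: F`_i.
pose s (w : 'rV[R]_n) : R := \sum_(i < n) w ord0 i.
have g_cont : continuous g.
  apply: continuous_big => [|i _ w]; first exact: add_continuous.
  exact: (cvg_comp _ _ (@coord_continuous _ _ _ ord0 i w) (@scalel_continuous _ _ _ _)).
have s_cont : continuous s.
  apply: continuous_big => [|i _ w]; first exact: add_continuous.
  exact: coord_continuous.
pose K : set 'rV[R]_n := [set w : 'rV[R]_n | forall i, `[0, 1]%classic (w ord0 i)] `&` s @^-1` [set 1].
have -> : region F = g @` K.
  apply/seteqP; split => [x [w [w0 [w1 ->]]]|x [w [w0 w1] <-]].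
    exists (\row_i w i); last by apply: eq_bigr => i _; rewrite mxE.
    split => [i|] /=; last by rewrite /s -[RHS]w1; apply: eq_bigr => i _; rewrite mxE.
    rewrite mxE in_itv /= w0 -w1 (bigD1 i) //= lerDl.
    by apply: sumr_ge0.
  exists (w ord0); split; last by split.
  by move=> i; have := w0 i; rewrite /= in_itv /= => /andP[].
apply: continuous_compact; first exact: continuous_subspaceT.
apply: compact_closedI; last first.
  by apply: closed_comp => [w _|]; [exact: s_cont|exact: closed_eq].
apply: (@rV_compact R n (fun=> `[0, 1]%classic)) => _; exact: segment_compact.
Qed.

Lemma surface_closed P : closed (surface P).
Proof.
elim: P => [|F P IH].
  rewrite (_ : surface [::] = set0); first exact: closed0.
  by apply/seteqP; split => // x [].
rewrite (_ : surface (F :: P) = region F `|` surface P).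
  by apply: closedU => //; exact: region_closed.
apply/seteqP; split => [x [G]|x [Fx|[G GP Gx]]].
- by rewrite inE => /orP[/eqP ->|GP Gx]; [left|right; exists G].
- by exists F; rewrite ?mem_head.
- by exists G; rewrite ?inE ?GP ?orbT.
Qed.

(** The faces on each side of [g] form a closed set, and the two sets meet only in shared vertices
    and edges, all of which are cut. Barycenters of [F0] and [G0] show that neither side
    vanishes. *)
Lemma cut_disconnects P (E : seq ('rV[R]_3 * 'rV[R]_3)) (g : pred (face R)) F0 G0 :
  polyhedron P -> (forall F, F \in P -> convex_face F) ->
  (forall e, e \in E -> exists2 F, F \in P & is_edge_of F e) ->
  F0 \in P -> g F0 -> G0 \in P -> ~~ g G0 ->
  (forall F G, F \in P -> G \in P -> g F -> ~~ g G ->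
    (forall w, w \in F -> w \in G -> exists2 e, e \in E & w = e.1 \/ w = e.2) /\
    (forall e, e \in edges F -> is_edge_of G e -> has (same_edge e) E)) ->
  ~ connected (surface P `\` cutset E).
Proof.
move=> P_poly P_conv E_edges F0P gF0 G0P gG0 sep conn.
set A := surface P `\` cutset E in conn *.
have barycenter F : F \in P -> exists x, [/\ A x, region F x &
    forall G, G \in P -> F != G -> ~ region G x].
  move=> FP; have [F2 uF _] := P_conv F FP.
  have [a [b [c [aF bF cF uabc]]]] : exists a b c,
      [/\ a \in F, b \in F, c \in F & uniq [:: a; b; c]].
    case: F F2 uF {FP} => [|a [|b [|c F]]] // _ /= /and4P[aF bF _ _].
    exists a, b, c; rewrite !inE !eqxx !orbT; split => //.
    by move: aF bF; rewrite !inE !negb_or => /and3P[-> -> _] /andP[-> _].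
  have p3 : 0 < 3^-1 :> R by rewrite invr_gt0.
  have s3 : 3^-1 + 3^-1 + 3^-1 = 1 :> R by field.
  exists (3^-1 *: a + 3^-1 *: b + 3^-1 *: c).
  have Fx : region F (3^-1 *: a + 3^-1 *: b + 3^-1 *: c).
    by apply: region_comb => //; exact: ltW.
  split => //.
    split; first by exists F.
    exact: (open_face_uncut P_poly P_conv E_edges FP).
  by move=> G GP FG; apply: (open_face_meet P_poly P_conv FP GP FG).
have split_surface x : A x -> surface [seq F <- P | g F] x ->
    ~ surface [seq F <- P | ~~ g F] x.
  move=> [_ Ex] [F]; rewrite mem_filter => /andP[gF FP] Fx.
  move=> [G]; rewrite mem_filter => /andP[gG GP] Gx; apply: Ex.
  have FG : F != G by apply: contraNneq gG => <-.
  have [sepv sepe] := sep F G FP GP gF gG.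
  have [[w [wF wG ->]]|[e [eF eG ex]]] := polyhedron_meet P_poly FP GP FG Fx Gx.
    have [e eE ew] := sepv w wF wG; exists e => //.
    case: ew => ->; first by exists 0; rewrite lexx ler01 subr0 scale1r scale0r addr0.
    by exists 1; rewrite lexx ler01 subrr scale1r scale0r add0r.
  have /hasP[e' e'E ee'] := sepe e eF eG.
  by exists e' => //; apply: same_edge_segment ex.
have [x [Ax F0x _]] := barycenter _ F0P.
have [y [Ay _ Gy]] := barycenter _ G0P.
(* [connected] makes a nonempty, relatively open and closed part of [A] equal to [A]; openness comes
   from the complement of the other closed part. *)
have AE : A `&` surface [seq F <- P | g F] = A.
  apply: conn.
  - by exists x; split => //; exists F0; rewrite ?mem_filter ?gF0.
  - exists (~` surface [seq F <- P | ~~ g F]).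
      by apply: closed_openC; exact: surface_closed.
    apply/seteqP; split => z [Az gz]; split => //; first exact: split_surface.
    have [[F FP Fz] _] := Az.
    have [gF|gF] := boolP (g F); first by exists F; rewrite ?mem_filter ?gF.
    by case: gz; exists F; rewrite ?mem_filter ?gF.
  - by exists (surface [seq F <- P | g F]) => //; exact: surface_closed.
have [_ [F]] : (A `&` surface [seq F <- P | g F]) y by rewrite AE.
rewrite mem_filter => /andP[gF FP]; apply: Gy => //.
by apply: contraNneq gG0 => ->.
Qed.

End Separation.

(** * Convexity of triangles and trapezoids *)

Section ConvexFaces.
Variable R : realType.
Implicit Types (p q c w u : 'rV[R]_3) (F : face R) (l s t : R).

Lemma gram_residual u w : let z := dotv u u *: w - dotv w u *: u in
  dotv z z = dotv u u * gram w u.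
Proof. by rewrite /gram !dotvE (dotvC u w); ring. Qed.

(** Squared area scales by the squared determinant, so independence inside a face is read off from
    coordinates. *)
Lemma gram_comb u w (a b c d : R) :
  gram (a *: u + b *: w) (c *: u + d *: w) = (a * d - b * c) ^+ 2 * gram u w.
Proof. by rewrite /gram !dotvE (dotvC w u); ring. Qed.

Lemma gramC u w : gram u w = gram w u.
Proof. by rewrite /gram (dotvC w u) mulrC. Qed.

Lemma gram_rotate p q c : gram (c - q) (p - q) = gram (q - p) (c - p).
Proof.
have -> : c - q = (-1) *: (q - p) + 1 *: (c - p).
  by apply/rowP => i; rewrite !mxE; ring.
have -> : p - q = (-1) *: (q - p) + 0 *: (c - p).
  by apply/rowP => i; rewrite !mxE; ring.
by rewrite gram_comb; ring.
Qed.

Lemma gram_neq p q c : 0 < gram (q - p) (c - p) -> uniq [:: p; q; c].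
Proof.
rewrite /= !inE !andbT negb_or => g0; apply/andP; split; first apply/andP; first split.
- by apply: contraTneq g0 => ->; rewrite /gram subrr !dotv0l mul0r expr0n subrr ltxx.
- by apply: contraTneq g0 => ->; rewrite gramC /gram subrr !dotv0l mul0r expr0n subrr ltxx.
- by apply: contraTneq g0 => ->; rewrite /gram expr2 subrr ltxx.
Qed.

Lemma uniq3 (T : eqType) (a b c : T) :
  uniq [:: a; b; c] -> [/\ a != b, a != c & b != c].
Proof. by rewrite /= !inE negb_or andbT => /andP[/andP[]]. Qed.

Lemma gram_vector u w : exists nv, dotv nv u = 0 /\ dotv nv w = gram u w.
Proof.
exists (dotv u u *: w - dotv u w *: u).
by split; rewrite /gram !dotvE ?(dotvC w u); ring.
Qed.

(** The normal is a multiple of the part of [c - p] orthogonal to [q - p]: it only sees the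
    coordinate [t] of [w] across the side. *)
Lemma support_line p q c : 0 < gram (q - p) (c - p) ->
  exists nv d, [/\ dotv nv p = d, dotv nv q = d &
    forall w s t, 0 < t -> w - p = s *: (q - p) + t *: (c - p) -> d < dotv nv w].
Proof.
have [nv [nu nz]] := gram_vector (q - p) (c - p).
move=> g0; exists nv, (dotv nv p); split => //.
  by rewrite -[in LHS](subrK p q) dotvDr nu add0r.
move=> w s t t0 wE.
rewrite -[in ltRHS](subrK p w) wE dotvDr (dotvDr nv (s *: _)) !(dotvZr _ nv) nu nz.
by rewrite mulr0 add0r ltrDr mulr_gt0.
Qed.

Lemma triangle_convex p q c : 0 < gram (q - p) (c - p) -> convex_face [:: p; q; c].
Proof.
move=> g0; split => //; first exact: gram_neq.
have side a b d : 0 < gram (b - a) (d - a) -> [:: a; b; d] =i [:: p; q; c] ->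
    exists nv r, [/\ dotv nv a = r, dotv nv b = r &
    forall w, w \in [:: p; q; c] -> w != a -> w != b -> r < dotv nv w].
  move=> g1 mem_abd; have [nv [r [h1 h2 h3]]] := support_line g1.
  exists nv, r; split => // w; rewrite -mem_abd !inE => + /negPf wa /negPf wb.
  rewrite wa wb /= => /eqP ->; apply: (h3 _ 0 1) => //.
  by rewrite scale0r scale1r add0r.
rewrite /strictly_convex (_ : edges _ = [:: (p, q); (q, c); (c, p)]) // => e.
rewrite !inE => /or3P[] /eqP -> /=; [by apply: (side p q c)|apply: (side q c p)|apply: (side c p q)].
- by rewrite gram_rotate.
- by move=> w; rewrite !inE; case: (w == p); case: (w == q); case: (w == c).
- by rewrite gram_rotate gram_rotate.
- by move=> w; rewrite !inE; case: (w == p); case: (w == q); case: (w == c).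
Qed.

(** For each side, a third vertex completes a basis ([g1] to [g4]) in which both vertices off that
    side have positive second coordinate. *)
Lemma trapezoid_convex p u w l : 0 < l -> 0 < gram u w ->
  convex_face [:: p; p + u; p + w + l *: u; p + w].
Proof.
move=> l0 g0; have l1 := lt0r_neq0 l0.
have sub (a b c d : R) x y : y - x = a *: u + b *: w -> 
    forall z, z - x = c *: u + d *: w -> a * d - b * c != 0 -> 0 < gram (y - x) (z - x).
  move=> -> z -> n0; rewrite gram_comb mulr_gt0 // lt_def sqr_ge0 andbT.
  by rewrite expf_neq0.
have g1 : 0 < gram (p + u - p) (p + w - p).
  apply: (sub 1 0 0 1); try (by apply/rowP => i; rewrite !mxE; ring).
  by rewrite mul1r mul0r subr0 oner_eq0.
have g2 : 0 < gram (p + w + l *: u - (p + u)) (p - (p + u)).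
  apply: (sub (l - 1) 1 (-1) 0); try (by apply/rowP => i; rewrite !mxE; ring).
  by rewrite mulr0 sub0r mulrN1 opprK oner_eq0.
have g3 : 0 < gram (p + w - (p + w + l *: u)) (p - (p + w + l *: u)).
  apply: (sub (- l) 0 (- l) (-1)); try (by apply/rowP => i; rewrite !mxE; ring).
  by rewrite mul0r subr0 mulrN1 opprK.
have g4 : 0 < gram (p - (p + w)) (p + u - (p + w)).
  apply: (sub 0 (-1) 1 (-1)); try (by apply/rowP => i; rewrite !mxE; ring).
  by rewrite mul0r sub0r mulr1 opprK oner_eq0.
split => //.
  have [ab ad bd] := uniq3 (gram_neq g1).
  have [bc _ ca] := uniq3 (gram_neq g2); have [cd _ _] := uniq3 (gram_neq g3).
  by rewrite /= !inE !negb_or ab ad bd bc cd eq_sym ca.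
rewrite /strictly_convex (_ : edges _ = [:: (p, p + u); (p + u, p + w + l *: u);
  (p + w + l *: u, p + w); (p + w, p)]) // => e.
rewrite !inE => /or4P[] /eqP -> /=.
- have [nv [d [h1 h2 h3]]] := support_line g1; exists nv, d; split => // z.
  rewrite !inE => /or4P[] /eqP -> z1 z2; move: z1 z2; rewrite ?eqxx // => _ _.
    by apply: (h3 _ l 1) => //; apply/rowP => i; rewrite !mxE; ring.
  by apply: (h3 _ 0 1) => //; apply/rowP => i; rewrite !mxE; ring.
- have [nv [d [h1 h2 h3]]] := support_line g2; exists nv, d; split => // z.
  rewrite !inE => /or4P[] /eqP -> z1 z2; move: z1 z2; rewrite ?eqxx // => _ _.
    by apply: (h3 _ 0 1) => //; apply/rowP => i; rewrite !mxE; ring.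
  by apply: (h3 _ 1 l) => //; apply/rowP => i; rewrite !mxE; ring.
- have [nv [d [h1 h2 h3]]] := support_line g3; exists nv, d; split => // z.
  rewrite !inE => /or4P[] /eqP -> z1 z2; move: z1 z2; rewrite ?eqxx // => _ _.
    by apply: (h3 _ 0 1) => //; apply/rowP => i; rewrite !mxE; ring.
  by apply: (h3 _ (- l^-1) 1) => //; apply/rowP => i; rewrite !mxE; field.
- have [nv [d [h1 h2 h3]]] := support_line g4; exists nv, d; split => // z.
  rewrite !inE => /or4P[] /eqP -> z1 z2; move: z1 z2; rewrite ?eqxx // => _ _.
    by apply: (h3 _ 0 1) => //; apply/rowP => i; rewrite !mxE; ring.
  by apply: (h3 _ (- l) l) => //; apply/rowP => i; rewrite !mxE; ring.
Qed.

Lemma cyclic_predecessor n k : (2 < n)%N -> (k < n)%N ->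
  ((k + n).-1 %% n)%N != k /\ ((k + n).-1 %% n)%N != (k.+1 %% n)%N.
Proof.
case: n => [|[|[|n]]] // _; case: k => [|k] kn.
  by rewrite add0n /= !modn_small.
rewrite addSn /= modnDr modn_small; last exact: ltnW.
split; first by rewrite ltn_eqF.
move: kn; rewrite leq_eqVlt => /orP[/eqP [->]|kn]; first by rewrite modnn.
by rewrite modn_small // ltn_eqF.
Qed.

(** Were the two sides at the vertex collinear, the functional supporting the next side would be
    constant along the previous one too, yet it is strictly larger at the preceding vertex. *)
Lemma convex_face_interior_angle F k : convex_face F -> (k < size F)%N ->
  interior_angle F k < pi.
Proof.
move=> [F2 uF scF] kF; apply: vangle_lt_pi.
set n := size F in F2 kF *.
have n0 : (0 < n)%N by exact: leq_ltn_trans kF.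
have prev_lt : ((k + n).-1 %% n < n)%N by rewrite ltn_pmod.
have next_lt : (k.+1 %% n < n)%N by rewrite ltn_pmod.
have eF : (F`_k, F`_(k.+1 %% n)) \in edges F by apply/edgesP; exists k.
have [prev_k prev_next] : ((k + n).-1 %% n)%N != k /\ ((k + n).-1 %% n)%N != (k.+1 %% n)%N.
  exact: cyclic_predecessor.
have [nv [d [h1 h2 h3]]] := scF _ eF; rewrite /= in h1 h2 h3.
have := h3 F`_((k + n).-1 %% n); rewrite mem_nth // !nth_uniq // => /(_ isT prev_k prev_next).
have := edges_neq uF (ltnW F2) eF; rewrite /= eq_sym -subr_eq0.
set cur := F`_k in h1 h2 *; set nxt := F`_(k.+1 %% n) in h2 *; set prv := F`_(_ %% _).
move=> /dotvv_gt0 pp dlt.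
rewrite lt_def subr_ge0 cauchy_schwarz andbT; apply/eqP => g0.
set p := nxt - cur in pp g0; set q := prv - cur in g0.
have := gram_residual p q; rewrite [gram q p]g0 mulr0 => /dotvv_eq0.
move: (dotv q p) => z; move: (dotv p p) pp => y y0.
move=> /(congr1 (dotv nv)); rewrite !dotvE h1 h2 subrr mulr0 subr0.
have -> : dotv nv (0 : 'rV[R]_3) = 0 by rewrite dotvC dotv0l.
by move=> /eqP; rewrite mulf_eq0 (gt_eqF y0) /= subr_eq0 => /eqP ee; move: dlt; rewrite ee ltxx.
Qed.

End ConvexFaces.

(** * Finite combinatorics of faces with labelled vertices *)

Section LabelledFaces.
Implicit Types (L X : seq (seq nat)) (F G : seq nat) (e : nat * nat).
Implicit Types (cl I S : seq (nat * nat)).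

Definition lab_edges F : seq (nat * nat) :=
  [seq (nth 0%N F i, nth 0%N F (i.+1 %% size F)) | i <- iota 0 (size F)].

Definition lab_same e e' : bool :=
  ((e.1 == e'.1) && (e.2 == e'.2)) || ((e.1 == e'.2) && (e.2 == e'.1)).

Definition lab_is_edge F e : bool := has (lab_same e) (lab_edges F).

Definition glued cl F G : bool :=
  has (fun e => lab_is_edge G e && ~~ has (lab_same e) cl) (lab_edges F).

(* The faces reachable from the first one across the edges not in [cl]. *)
Definition lab_component L cl : seq (seq nat) :=
  iter (size L)
    (fun X => [seq F <- L | (F \in X) || has (fun G => glued cl G F) X])
    (take 1 L).

(** Boolean form of the hypothesis of [cut_disconnects] on two faces from different sides. *)
Definition lab_cut_between cl F G : bool :=
  all (fun w => (w \in G) ==> has (fun e => (w == e.1) || (w == e.2)) cl) F &&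
  all (fun e => lab_is_edge G e ==> has (lab_same e) cl) (lab_edges F).

(** These checks feed [cut_disconnects] directly, so nothing has to be proved about [lab_component]:
    it merely proposes a side. *)
Definition lab_separated L cl : bool :=
  let X := lab_component L cl in
  [&& has (mem X) L, has (predC (mem X)) L &
      all (fun F => all (fun G =>
        ((F \in X) && (G \notin X)) ==> lab_cut_between cl F G) L) L].

Fixpoint sublists (T : Type) (s : seq T) : seq (seq T) :=
  if s is x :: s' then let r := sublists s' in r ++ [seq x :: t | t <- r]
  else [:: [::]].

Lemma filter_sublists (T : eqType) (a : pred T) (s : seq T) :
  [seq x <- s | a x] \in sublists s.
Proof.
elim: s => //= x s IH; rewrite mem_cat; case: (a x); last by rewrite IH.
by rewrite map_f ?orbT.
Qed.

Definition lab_covers cl S : bool := all (fun e => has (lab_same e) cl) S.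

(** Enumerates the possible traces of a cut on the inner edges: each one that meets all arcs must
    contain a separator. *)
Definition arcs_separate L I (arcs seps : seq (seq (nat * nat))) : bool :=
  [&& all (lab_covers I) arcs, all (lab_separated L) seps &
      all (fun cl => has (lab_covers cl) seps)
        [seq cl <- sublists I | all (has (fun e => has (lab_same e) cl)) arcs]].

Variables (R : realType) (s : seq 'rV[R]_3).
Hypothesis s_uniq : uniq s.

Definition lab_pt : nat -> 'rV[R]_3 := nth 0 s.
Definition lab_face F : face R := map lab_pt F.
Definition lab_pair e := (lab_pt e.1, lab_pt e.2).

Definition lab_ok F := all (fun i => i < size s)%N F.

Lemma lab_ptK i : (i < size s)%N -> index (lab_pt i) s = i.
Proof. by move=> si; rewrite index_uniq. Qed.

Lemma lab_faceK F : lab_ok F -> map (index^~ s) (lab_face F) = F.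
Proof.
move=> /allP sF; rewrite -map_comp -[RHS]map_id; apply/eq_in_map => i /sF.
exact: lab_ptK.
Qed.

Lemma edges_lab_face F : edges (lab_face F) = map lab_pair (lab_edges F).
Proof.
rewrite /edges size_map -map_comp; apply/eq_in_map => i; rewrite mem_iota /= => iF.
have F0 : (0 < size F)%N by exact: leq_ltn_trans iF.
by rewrite /lab_pair /= !(nth_map 0%N) // ltn_pmod.
Qed.

Lemma mem_lab_face F i : lab_ok F -> (i < size s)%N -> (lab_pt i \in lab_face F) = (i \in F).
Proof.
move=> sF si; apply/mapP/idP => [[j jF ij]|iF]; last by exists i.
by rewrite -(lab_ptK si) ij lab_ptK // (allP sF).
Qed.

Lemma lab_edges_mem F e : e \in lab_edges F -> e.1 \in F /\ e.2 \in F.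
Proof.
move=> /mapP[i]; rewrite mem_iota /= => iF -> /=.
by rewrite !mem_nth // ltn_pmod // (leq_ltn_trans _ iF).
Qed.

Definition lab_edge_ok e := ((e.1 < size s) && (e.2 < size s))%N.

Lemma lab_edges_ok F e : lab_ok F -> e \in lab_edges F -> lab_edge_ok e.
Proof.
by move=> /allP sF /lab_edges_mem[e1 e2]; apply/andP; split; exact: sF.
Qed.

Lemma lab_sameP e e' : lab_edge_ok e -> lab_edge_ok e' ->
  same_edge (lab_pair e) (lab_pair e') = lab_same e e'.
Proof.
case: e e' => a b [c d] /andP[/= sa sb] /andP[/= sc sd].
by rewrite /same_edge /lab_same /= !nth_uniq.
Qed.

Lemma lab_is_edgeP F e : lab_ok F -> lab_edge_ok e ->
  is_edge_of (lab_face F) (lab_pair e) = lab_is_edge F e.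
Proof.
move=> sF se; rewrite /is_edge_of edges_lab_face has_map.
by apply: eq_in_has => e' e'F; apply: lab_sameP => //; exact: lab_edges_ok e'F.
Qed.

Lemma nfaces_at_lab L e : all lab_ok L -> lab_edge_ok e ->
  nfaces_at (map lab_face L) (lab_pair e) = count (lab_is_edge^~ e) L.
Proof.
move=> /allP sL se; rewrite /nfaces_at count_map.
by apply: eq_in_count => F /sL sF; exact: lab_is_edgeP.
Qed.

(** The bridge from geometry to computation: the only metric input is that every arc contains a cut
    edge. Filtering [I] by [cut] gives one of the enumerated sets. *)
Lemma no_edge_unfolding_lab L I arcs seps : all lab_ok L ->
  all lab_edge_ok I -> all (all lab_edge_ok) arcs -> all (all lab_edge_ok) seps ->
  polyhedron (map lab_face L) ->
  (forall F : face R, F \in map lab_face L -> convex_face F) ->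
  arcs_separate L I arcs seps ->
  (forall E, edge_unfolding (map lab_face L) E -> forall arc, arc \in arcs ->
     exists2 e, e \in arc & has (same_edge (lab_pair e)) E) ->
  ~ has_edge_unfolding (map lab_face L).
Proof.
move=> /allP sL /allP sI /allP sarcs /allP sseps P_poly P_conv.
move=> /and3P[/allP arcsI /allP sepL /allP sepI] arcsE [E unf].
pose cut e := has (same_edge (lab_pair e)) E.
have cut_same e e' : lab_edge_ok e -> lab_edge_ok e' -> lab_same e e' -> cut e -> cut e'.
  move=> se se' ee' /hasP[d dE ed]; apply/hasP; exists d => //.
  by apply: same_edge_trans ed; rewrite same_edge_sym lab_sameP.
have cut_covers (S : seq (nat * nat)) e : {in S, forall d, cut d} -> all lab_edge_ok S ->
    lab_edge_ok e -> has (lab_same e) S -> exists2 e', e' \in E & same_edge (lab_pair e) e'.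
  move=> cS /allP sS se /hasP[d dS ed]; have /hasP[d' d'E dd'] := cS _ dS.
  exists d' => //; apply: same_edge_trans dd'; rewrite lab_sameP //; exact: sS.
have [S Ssep S_cut] : exists2 S, S \in seps & {in S, forall e, cut e}.
  have : [seq e <- I | cut e] \in
      [seq cl <- sublists I | all (has (fun e => has (lab_same e) cl)) arcs].
    rewrite mem_filter filter_sublists andbT.
    apply/allP => arc arcA; have [e ea e_cut] := arcsE E unf arc arcA.
    apply/hasP; exists e => //.
    have /hasP[d dI ed] := allP (arcsI _ arcA) _ ea.
    apply/hasP; exists d => //; rewrite mem_filter dI andbT.
    apply: cut_same ed e_cut; [exact: (allP (sarcs _ arcA))|exact: sI].
  move=> /sepI/hasP[S Ssep /allP covS]; exists S => // e eS.
  have /hasP[d] := covS _ eS; rewrite mem_filter => /andP[d_cut dI] ed.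
  apply: cut_same d_cut; [exact: sI|exact: (allP (sseps _ Ssep))|].
  by move: ed; rewrite /lab_same !(eq_sym e.1) !(eq_sym e.2) [X in _ || X]andbC.
have S_ok := sseps _ Ssep.
have := sepL _ Ssep.
move=> /and3P[/hasP[F0 F0L gF0] /hasP[G0 G0L gG0] /allP sep].
set X := lab_component L S in gF0 gG0 sep.
have [E_edges _ conn _] := unf.
(* Sides are assigned to geometric faces by reading the labels back with [index], which is faithful
   because the vertices are distinct. *)
apply: (@cut_disconnects R (map lab_face L) E (fun F : face R => map (index^~ s) F \in X)
  (lab_face F0) (lab_face G0)) conn => //; rewrite ?map_f ?lab_faceK ?sL //.
move=> F G /mapP[F' F'L ->] /mapP[G' G'L ->].
have sF' := sL _ F'L; have sG' := sL _ G'L.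
rewrite !lab_faceK // => FX GX.
have /= := allP (sep _ F'L) _ G'L; rewrite FX GX /= => /andP[/allP cv /allP ce].
split=> [w /mapP[i iF ->]|e].
  have si : (i < size s)%N by exact: (allP sF').
  rewrite mem_lab_face // => iG; have := cv _ iF; rewrite iG => /hasP[d dcl].
  have sd := allP S_ok _ dcl.
  have dd : has (lab_same d) S by apply/hasP; exists d; rewrite // /lab_same !eqxx.
  have [e' e'E /same_edgeP de'] := cut_covers S d S_cut S_ok sd dd.
  move=> id; exists e' => //.
  case: e' de' {e'E} => a b /= [] [<- <-]; case/orP: id => /eqP ->; by [left|right].
rewrite edges_lab_face => /mapP[d dF ->].
have sd := lab_edges_ok sF' dF.
rewrite lab_is_edgeP // => dG.
have := ce _ dF; rewrite dG => dS.
by have [e' e'E de'] := cut_covers S d S_cut S_ok sd dS; apply/hasP; exists e'.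
Qed.

End LabelledFaces.

(* Labels: 0 is the tip, 1, 2, 3 the middle vertices, 4, 5, 6 the corners. *)

(* The middle triangle, and the paths joining two corners through one edge of
   the middle triangle, through its two other edges, or through the tip;
   [spokes i] lists the edges from the middle vertex [i] to the corners. *)
Definition middle_separators (spokes : nat -> seq (nat * nat)) :
    seq (seq (nat * nat)) :=
  ([:: (1, 2); (2, 3); (3, 1)] ::
  flatten [seq
    [seq ends ++ route |
      ends <- [seq [:: x; y] | x <- spokes p.1.1, y <- spokes p.1.2],
      route <- [:: [:: (p.1.1, p.1.2)]; [:: (p.1.1, p.2); (p.2, p.1.2)];
                   [:: (0, p.1.1); (0, p.1.2)]]]
    | p <- [:: (1, 2, 3); (2, 3, 1); (3, 1, 2)]])%N.

Definition basic_labels : seq (seq nat) :=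
  [:: [:: 0; 1; 2]; [:: 0; 2; 3]; [:: 0; 3; 1];
      [:: 1; 2; 5; 4]; [:: 2; 3; 6; 5]; [:: 3; 1; 4; 6]]%N.

Definition basic_inner_edges : seq (nat * nat) :=
  [:: (0, 1); (0, 2); (0, 3); (1, 2); (2, 3); (3, 1); (1, 4); (2, 5); (3, 6)]%N.

(* The inner edges met when turning around [v] from the edge to [A_j0] over [k]
   faces, the edges at [v] leading to [A_0, A_1, ...] in cyclic order. *)
Definition arc_edges (v : nat) (A : seq nat) (j0 k : nat) : seq (nat * nat) :=
  [seq (v, nth 0 A ((j0 + j) %% size A))%N | j <- iota 1 k.-1].

(** The pairs (1, 3) and (0, 3) leave out one spike face. The full turn (2, 4) starts at the edge to
    the corner, so that edge cannot be the only one cut at the vertex. *)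
Definition basic_arcs : seq (seq (nat * nat)) :=
  [seq arc_edges x.1 x.2 y.1 y.2 |
    x <- [:: (1, [:: 0; 2; 4; 3]); (2, [:: 0; 3; 5; 1]); (3, [:: 0; 1; 6; 2])],
    y <- [:: (1, 3); (0, 3); (2, 4)]]%N.

Definition basic_separators : seq (seq (nat * nat)) :=
  middle_separators (fun i => [:: (i, i + 3)%N]).

Lemma basic_arcs_separate :
  arcs_separate basic_labels basic_inner_edges basic_arcs basic_separators.
Proof. by vm_compute. Qed.

Definition triangulated_labels : seq (seq nat) :=
  [:: [:: 0; 1; 2]; [:: 0; 2; 3]; [:: 0; 3; 1];
      [:: 1; 2; 4]; [:: 4; 5; 2];
      [:: 2; 3; 5]; [:: 5; 6; 3];
      [:: 3; 1; 6]; [:: 6; 4; 1]]%N.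

Definition triangulated_inner_edges : seq (nat * nat) :=
  [:: (0, 1); (0, 2); (0, 3); (1, 2); (2, 3); (3, 1);
      (1, 4); (2, 4); (2, 5); (3, 5); (3, 6); (1, 6)]%N.

(** Here (1, 4) and (0, 4) leave out one spike face, and the full turns (2, 5) and (3, 5) start at
    the two edges to corners. *)
Definition triangulated_arcs : seq (seq (nat * nat)) :=
  [seq arc_edges x.1 x.2 y.1 y.2 |
    x <- [:: (1, [:: 0; 2; 4; 6; 3]); (2, [:: 0; 3; 5; 4; 1]); (3, [:: 0; 1; 6; 5; 2])],
    y <- [:: (1, 4); (0, 4); (2, 5); (3, 5)]]%N.

Definition triangulated_spokes (i : nat) : seq (nat * nat) :=
  [:: (i, i + 3); (i, if i == 1 then 6 else i + 2)]%N.

(** Unlike on a basic hat, a middle vertex has two spokes; cutting both detaches the brim triangle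
    between them. *)
Definition triangulated_separators : seq (seq (nat * nat)) :=
  map triangulated_spokes [:: 1; 2; 3]%N ++ middle_separators triangulated_spokes.

Lemma triangulated_arcs_separate :
  arcs_separate triangulated_labels triangulated_inner_edges triangulated_arcs
    triangulated_separators.
Proof. by vm_compute. Qed.

(** * Face angles at the middle vertices *)

Section Angles.
Variable R : realType.
Implicit Types (p q c u w T Ma Mb Ca Cb : 'rV[R]_3) (t a b g l : R).

Lemma enormZ n (k : R) (u : 'rV[R]_n) : 0 <= k -> enorm (k *: u) = k * enorm u.
Proof.
move=> k0; rewrite /enorm dotvZl dotvZr mulrA -expr2 sqrtrM ?sqr_ge0 //.
by rewrite sqrtr_sqr ger0_norm.
Qed.

(** The half-angle formula gives the base length 2 |u| sin (t / 2), and the cosine of the claimed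
    angle is sin (t / 2). *)
Lemma isosceles_base_angle u w t : has_angle u w t -> enorm u = enorm w ->
  has_angle (w - u) (- u) ((pi - t) / 2).
Proof.
move=> [u0 w0 /andP[t0 tpi] uw] e.
have e0 := enorm_gt0 u0.
have ct : cos t = 1 - 2 * sin (t / 2) ^+ 2.
  by rewrite {1}(_ : t = t / 2 + t / 2) ?cosD -?expr2 ?cos2sin2; [ring|field].
have s0 : 0 < sin (t / 2) by apply: sin_gt0_pi; apply/andP; split; lra.
have d2 : dotv (w - u) (w - u) = (2 * enorm u * sin (t / 2)) ^+ 2.
  rewrite !dotvE (dotvC w u) uw -!enorm_sqr -e ct; ring.
have en : enorm (w - u) = 2 * enorm u * sin (t / 2).
  by rewrite /enorm d2 sqrtr_sqr ger0_norm // !mulr_ge0 // ltW.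
split; rewrite ?oppr_eq0 //.
- apply: contraTneq s0 => wu0; move/eqP: en; rewrite wu0 /enorm dotv0l sqrtr0.
  by rewrite eq_sym !mulf_eq0 pnatr_eq0 (gt_eqF e0) /= => /eqP ->; rewrite ltxx.
- by apply/andP; split; lra.
rewrite enormN en (_ : (pi - t) / 2 = pi / 2 - t / 2); last by rewrite mulrBl.
rewrite cosB cos_pihalf sin_pihalf mul0r add0r mul1r.
by rewrite !dotvE (dotvC w u) uw -enorm_sqr -e ct; ring.
Qed.

(** With base [d] and legs [x], [y], the projection formula reads d = (x + y) cos b. Comparing the
    inner products at the two ends then forces x = y, and the apex cosine comes out as - cos (2
    b). *)
Lemma equal_angles_apex p q c b : 0 < b < pi / 2 ->
  has_angle (q - p) (c - p) b -> has_angle (p - q) (c - q) b ->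
  has_angle (p - c) (q - c) (pi - b *+ 2).
Proof.
move=> /andP[b0 b2] [qp cp _ h1] [pq cq _ h2].
have cb : 0 < cos b.
  by apply: cos_gt0_pihalf; apply/andP; split; have := pi_gt0 R; lra.
have sb : 0 < sin b by apply: sin_gt0_pi; apply/andP; split; lra.
set d := enorm (q - p) in h1; set x := enorm (c - p) in h1.
set y := enorm (c - q) in h2.
have d0 : 0 < d by apply: enorm_gt0.
have x0 : 0 < x by apply: enorm_gt0.
have y0 : 0 < y by apply: enorm_gt0.
have ed : enorm (p - q) = d by rewrite -opprB enormN.
rewrite ed in h2.
set z := dotv (p - c) (q - c).
have xx : dotv (c - p) (c - p) = x ^+ 2 by rewrite enorm_sqr.
have yy : dotv (c - q) (c - q) = y ^+ 2 by rewrite enorm_sqr.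
have dd : dotv (q - p) (q - p) = d ^+ 2 by rewrite enorm_sqr.
have e1 : x ^+ 2 - z = d * x * cos b.
  rewrite -h1 -xx /z !dotvE ?(dotvC p c) ?(dotvC q c) ?(dotvC q p); ring.
have e2 : y ^+ 2 - z = d * y * cos b.
  rewrite -h2 -yy /z !dotvE ?(dotvC p c) ?(dotvC q c) ?(dotvC q p); ring.
have e3 : d ^+ 2 = x ^+ 2 + y ^+ 2 - 2 * z.
  rewrite -dd -xx -yy /z !dotvE ?(dotvC p c) ?(dotvC q c) ?(dotvC q p); ring.
have e4 : d = (x + y) * cos b.
  by apply: (mulfI (lt0r_neq0 d0)); rewrite -expr2 e3; lra.
have e5 : (x - y) * ((x + y) * sin b ^+ 2) = 0.
  rewrite sin2cos2; rewrite e4 in e1 e2.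
  transitivity ((x ^+ 2 - z - (x + y) * cos b * x * cos b) -
     (y ^+ 2 - z - (x + y) * cos b * y * cos b)); first by ring.
  by rewrite e1 e2; ring.
have xy : x = y.
  have p0 : 0 < (x + y) * sin b ^+ 2 by rewrite mulr_gt0 ?exprn_gt0 ?addr_gt0.
  by apply/eqP; rewrite -subr_eq0; move/eqP: e5; rewrite mulf_eq0 (gt_eqF p0) orbF.
split; [by rewrite -opprB oppr_eq0|by rewrite -opprB oppr_eq0| |].
  by apply/andP; split; lra.
have -> : enorm (p - c) = x by rewrite -opprB enormN.
have -> : enorm (q - c) = x by rewrite xy -opprB enormN.
rewrite cosB cospi sinpi mul0r addr0.
rewrite mulr2n cosD -!expr2 sin2cos2 !opprB -/z -[z]opprK.
have -> : - z = d * x * cos b - x ^+ 2 by rewrite -e1; ring.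
rewrite e4 -xy; ring.
Qed.

Lemma spike_angles a T Ma Mb : 0 < a < pi -> uniq [:: T; Ma; Mb] ->
  spike_ok a T Ma Mb ->
  has_angle (T - Ma) (Mb - Ma) a /\ has_angle (Ma - Mb) (T - Mb) a.
Proof.
move=> a0 /uniq3[TMa TMb MaMb] [_ h1 h2].
split; last by apply: has_angle_vangle; rewrite ?subr_eq0.
by apply: has_angle_sym; apply: has_angle_vangle; rewrite ?subr_eq0 // eq_sym.
Qed.

(** The top side is a positive multiple of the bottom one, so the upper angles are supplements of
    the lower ones. *)
Lemma trapezoid_angles b l Ma Mb Ca Cb : 0 < b < pi -> 1 < l ->
  uniq [:: Ma; Mb; Cb; Ca] -> trapezoid_ok b l Ma Mb Ca Cb ->
  has_angle (Mb - Ma) (Ca - Ma) (pi - b) /\ has_angle (Cb - Mb) (Ma - Mb) (pi - b).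
Proof.
rewrite /= !inE !negb_or !andbT => bpi l1 /and3P[/and3P[MM MaCb MaCa] /andP[MbCb MbCa] CC].
move=> [_ par h1 h2].
have l0 : 0 < l by exact: lt_trans l1.
have li0 : 0 < l^-1 by rewrite invr_gt0.
have key P Q M N : N - M = l^-1 *: (Q - P) -> P != Q -> P != M ->
    vangle (Q - P) (M - P) = b -> has_angle (N - M) (P - M) (pi - b).
  move=> NM PQ PM /has_angle_vangle h.
  have [//|//|//|_ _ _ dE] := h; rewrite ?subr_eq0 1?eq_sym //.
  split; rewrite ?subr_eq0 //.
  - by rewrite -subr_eq0 NM scaler_eq0 negb_or (gt_eqF li0) subr_eq0 eq_sym.
  - by case/andP: bpi => ? ?; apply/andP; split; lra.
  rewrite NM enormZ ?ltW // -(opprB M P) dotvNr dotvZl dE enormN.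
  by rewrite cosB cospi sinpi; ring.
split; first by apply: key par _ _ h1; rewrite // eq_sym.
apply: has_angle_sym; apply: key h2; rewrite // 1?eq_sym //.
by rewrite -opprB par -scalerN opprB.
Qed.

Lemma brim_angles b g Ma Mb Ca Cb : 0 < b < pi / 2 -> g < pi ->
  uniq [:: Ma; Mb; Ca] -> uniq [:: Ca; Cb; Mb] -> brim_tri_ok b g Ma Mb Ca Cb ->
  [/\ 0 < g, has_angle (Mb - Ma) (Ca - Ma) ((pi - g) / 2),
      has_angle (Ca - Mb) (Ma - Mb) ((pi - g) / 2) &
      has_angle (Cb - Mb) (Ca - Mb) (pi - b *+ 2)].
Proof.
move=> b0 gpi /uniq3[MM MaCa MbCa] /uniq3[CC CaMb CbMb] [hg eg h1 h2].
have u0 : Ma - Ca != 0 by rewrite subr_eq0.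
have w0 : Mb - Ca != 0 by rewrite subr_eq0.
have eE : enorm (Ma - Ca) = enorm (Mb - Ca).
  by rewrite -(opprB Ca Ma) -(opprB Ca Mb) !enormN.
(* With equal legs, a zero apex angle would make [Ma] and [Mb] coincide. *)
have g0 : 0 < g.
  rewrite lt_def -{2}hg vangle_ge0 // andbT; apply/eqP => g00.
  have := cos_vangle u0 w0; rewrite hg g00 cos0 mulr1 => dE.
  case/eqP: MM; apply/eqP; rewrite -subr_eq0; apply/eqP/dotvv_eq0.
  have -> : Ma - Mb = (Ma - Ca) - (Mb - Ca) by apply/rowP => i; rewrite !mxE; ring.
  move: dE eE; move: (Ma - Ca) (Mb - Ca) => u w dE eE.
  rewrite !dotvE (dotvC w u) dE -!enorm_sqr eE; ring.
have ga : has_angle (Ma - Ca) (Mb - Ca) g.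
  by apply: has_angle_vangle; rewrite // g0.
have bpi : 0 < b < pi.
  by case/andP: b0 => ? ?; apply/andP; split => //; have := pi_gt0 R; lra.
split => //.
- have := isosceles_base_angle ga eE.
  by rewrite (_ : _ - (Ma - Ca) = Mb - Ma) ?opprB //; apply/rowP => i; rewrite !mxE; ring.
- have := isosceles_base_angle (has_angle_sym ga) (esym eE).
  rewrite (_ : _ - (Mb - Ca) = Ma - Mb) ?opprB; first exact: has_angle_sym.
  by apply/rowP => i; rewrite !mxE; ring.
- apply: has_angle_sym; apply: equal_angles_apex => //.
    by apply: has_angle_vangle; rewrite // subr_eq0 eq_sym.
  by apply: has_angle_vangle; rewrite // subr_eq0 // eq_sym.
Qed.

End Angles.

(** * Faces in cyclic order around a vertex *)

Section Stars.
Variable R : realType.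
Implicit Types (P : seq (face R)) (v p q c : 'rV[R]_3) (E : seq ('rV[R]_3 * 'rV[R]_3)).

(* Consecutive faces [Fs] around [v]: the j-th one has the angle [xs_j] at [v],
   between the edges to [As_j] and [As_(j+1)], indices being cyclic. *)
Definition star P v (As : seq 'rV[R]_3) (Fs : seq (face R)) (xs : seq R) :=
  [/\ size As = size Fs, uniq Fs & forall j, (j < size Fs)%N ->
    [/\ nth [::] Fs j \in P, is_edge_of (nth [::] Fs j) (v, As`_j),
        As`_(j.+1 %% size Fs) \in nth [::] Fs j &
        has_angle (As`_j - v) (As`_(j.+1 %% size Fs) - v) xs`_j]].

(** Passes from cyclic indices to the linear ones of [wide_angle_cut]. For [k = size Fs] the arc is
    a full turn slit along its first edge, which then serves as both outer rays. *)
Lemma star_arc P E v As Fs xs (j0 k : nat) : polyhedron P ->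
  (forall F, F \in P -> convex_face F) -> edge_unfolding P E ->
  star P v As Fs xs -> (k <= size Fs)%N ->
  pi *+ 2 < \sum_(j < k) xs`_((j0 + j) %% size Fs) ->
  exists2 j, (0 < j < k)%N & has (same_edge (v, As`_((j0 + j) %% size Fs))) E.
Proof.
move=> P_poly P_conv unf [sAs uFs starP] kn wide.
set n := size Fs in sAs starP kn wide *.
have [k0|k0] := posnP k.
  by move: wide; rewrite k0 big_ord0 ltNge mulrn_wge0 ?pi_ge0.
have n0 : (0 < n)%N by exact: leq_trans kn.
have lt j : ((j0 + j) %% n < n)%N by rewrite ltn_pmod.
have succ j : (j0 + j.+1 = ((j0 + j) %% n).+1 %[mod n])%N.
  by rewrite addnS -(addn1 ((j0 + j) %% n)) modnDml addn1.
apply: (@wide_angle_cut R P E P_poly P_conv k v (fun j => As`_((j0 + j) %% n))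
  (fun j => nth [::] Fs ((j0 + j) %% n)) (fun j => xs`_((j0 + j) %% n))) => //.
- by move=> j _; have [] := starP _ (lt j).
- move=> i j /andP[ij jk]; rewrite nth_uniq // eqn_modDl.
  by rewrite !modn_small ?ltn_eqF //; [exact: leq_trans jk kn|exact: ltn_trans ij (leq_trans jk kn)].
- by move=> j _; have [_ /is_edge_of_mem[]] := starP _ (lt j).
- move=> j _; have [_ /is_edge_of_mem[_ Aj] AjS _] := starP _ (lt j).
  by split; rewrite // succ.
- by move=> j _; have [_ _ _] := starP _ (lt j); rewrite succ.
- by move=> j _; have [] := starP _ (lt j).
Qed.

Lemma star_arc_edges (s : seq 'rV[R]_3) P E (v : nat) (A : seq nat) Fs xs (j0 k : nat) :
  polyhedron P -> (forall F, F \in P -> convex_face F) -> edge_unfolding P E ->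
  star P (lab_pt s v) (map (lab_pt s) A) Fs xs -> (k <= size Fs)%N ->
  pi *+ 2 < \sum_(j < k) xs`_((j0 + j) %% size Fs) ->
  exists2 e, e \in arc_edges v A j0 k & has (same_edge (lab_pair s e)) E.
Proof.
move=> P_poly P_conv unf st kn wide.
have [sA _ _] := st; rewrite size_map in sA.
have [j /andP[j0' jk] cut] := star_arc P_poly P_conv unf st kn wide.
exists (v, nth 0%N A ((j0 + j) %% size A)).
  by apply/mapP; exists j; rewrite // mem_iota j0' add1n prednK // (leq_ltn_trans _ jk).
move: cut; rewrite /lab_pair /= (nth_map 0%N) sA // ltn_pmod // -sA.
by case: (A) sA kn => // <-; rewrite leqn0 => /eqP k0; rewrite k0 in jk.
Qed.

(** The barycenter of the triangle would lie in [G]. This refutes coincidences between vertices that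
    share no face. *)
Lemma nested_triangle P p q c G : polyhedron P ->
  (forall F, F \in P -> convex_face F) ->
  [:: p; q; c] \in P -> G \in P -> [:: p; q; c] != G ->
  p \in G -> q \in G -> c \in G -> False.
Proof.
move=> P_poly P_conv FP GP FG pG qG cG.
have [_ upqc _] := P_conv _ FP.
have p3 : 0 < 3^-1 :> R by rewrite invr_gt0.
have s3 : 3^-1 + 3^-1 + 3^-1 = 1 :> R by field.
apply: (open_face_meet P_poly P_conv FP GP FG _ _ _ upqc p3 p3 p3 s3).
- by rewrite !inE eqxx.
- by rewrite !inE eqxx !orbT.
- by rewrite !inE eqxx !orbT.
by apply: region_comb => //; exact: ltW.
Qed.

Lemma uniq_hat_points (T M1 M2 M3 C1 C2 C3 : 'rV[R]_3) :
  uniq [:: T; M1; M2] -> uniq [:: T; M2; M3] -> uniq [:: T; M3; M1] ->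
  C1 != C2 -> C2 != C3 -> C3 != C1 ->
  M1 != C1 -> M2 != C1 -> M2 != C2 -> M3 != C2 -> M3 != C3 -> M1 != C3 ->
  T != C1 -> T != C2 -> T != C3 -> M1 != C2 -> M2 != C3 -> M3 != C1 ->
  uniq [:: T; M1; M2; M3; C1; C2; C3].
Proof.
move=> /uniq3[h1 h2 h3] /uniq3[_ h4 h5] /uniq3[_ _ h6] *.
rewrite /= !inE !negb_or.
by repeat (apply/andP; split) => //; rewrite eq_sym.
Qed.

End Stars.

(** * Basic hats *)

Section BasicHat.
Variables (R : realType) (a b l : R).
Hypotheses (a_bd : 0 < a < pi) (b_bd : 0 < b < pi) (l_gt1 : 1 < l).

Lemma basic_star (P : seq (face R)) (T Ma Mb Mc Ca Cb Cc : 'rV[R]_3) :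
  let Fs := [:: [:: T; Ma; Mb]; [:: Ma; Mb; Cb; Ca]; [:: Mc; Ma; Ca; Cc]; [:: T; Mc; Ma]] in
  {subset Fs <= P} -> uniq Fs -> (forall F, F \in P -> uniq F) ->
  spike_ok a T Ma Mb -> spike_ok a T Mc Ma ->
  trapezoid_ok b l Ma Mb Ca Cb -> trapezoid_ok b l Mc Ma Cc Ca ->
  star P Ma [:: T; Mb; Ca; Mc] Fs [:: a; pi - b; pi - b; a].
Proof.
move=> Fs FsP uFs uP s1 s2 t1 t2.
have uF F : F \in Fs -> uniq F by move/FsP/uP.
have [a1 _] := spike_angles a_bd (uF [:: T; Ma; Mb] ltac:(by rewrite !inE eqxx)) s1.
have [_ a2] := spike_angles a_bd (uF [:: T; Mc; Ma] ltac:(by rewrite !inE eqxx !orbT)) s2.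
have [b1 _] := trapezoid_angles b_bd l_gt1
  (uF [:: Ma; Mb; Cb; Ca] ltac:(by rewrite !inE eqxx !orbT)) t1.
have [_ b2] := trapezoid_angles b_bd l_gt1
  (uF [:: Mc; Ma; Ca; Cc] ltac:(by rewrite !inE eqxx !orbT)) t2.
split => // -[|[|[|[|//]]]] _; (split; [by apply: FsP; rewrite !inE eqxx ?orbT
  |by rewrite /is_edge_of /same_edge /= !eqxx ?orbT|by rewrite !inE eqxx ?orbT|done]).
Qed.

Variables T M1 M2 M3 C1 C2 C3 : 'rV[R]_3.
Hypothesis ba : 2 * b < a.
Hypothesis hat : basic_hat a b l T M1 M2 M3 C1 C2 C3.

Let P := basic_hat_faces T M1 M2 M3 C1 C2 C3.
Let s := [:: T; M1; M2; M3; C1; C2; C3].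

Let P_labels : P = map (lab_face s) basic_labels.
Proof. by []. Qed.

Let P_poly : polyhedron P.
Proof. by case: hat. Qed.

Let P_uniq F : F \in P -> uniq F.
Proof. by case: P_poly => h _ _ _ /h[]. Qed.

Let spike_convex (Ma Mb : 'rV[R]_3) : spike_ok a T Ma Mb -> uniq [:: T; Ma; Mb] ->
  convex_face [:: T; Ma; Mb].
Proof.
move=> sp u; have [h _] := spike_angles a_bd u sp.
by apply: triangle_convex; rewrite -gram_rotate gramC; exact: has_angle_gram h.
Qed.

Let brim_convex (Ma Mb Ca Cb : 'rV[R]_3) : trapezoid_ok b l Ma Mb Ca Cb ->
  uniq [:: Ma; Mb; Cb; Ca] -> convex_face [:: Ma; Mb; Cb; Ca].
Proof.
move=> tr u; have [h _] := trapezoid_angles b_bd l_gt1 u tr.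
have [_ par _ _] := tr.
have l0 : 0 < l by exact: lt_trans l_gt1.
have := trapezoid_convex Ma l0 (has_angle_gram h).
have vec (x y : 'rV[R]_3) : x + (y - x) = y by rewrite addrC subrK.
by rewrite !vec par scalerA mulfV ?lt0r_neq0 // scale1r vec.
Qed.

Let P_convex F : F \in P -> convex_face F.
Proof.
case: hat => s1 s2 s3 [t1 t2 t3] _ FP; have := P_uniq FP.
by move: FP; rewrite !inE => /or4P[|||/or3P[]] /eqP ->;
  [exact: spike_convex|exact: spike_convex|exact: spike_convex
  |exact: brim_convex|exact: brim_convex|exact: brim_convex].
Qed.

Let inP i : (i < 6)%N -> nth [::] P i \in P.
Proof. by move=> i6; exact: mem_nth. Qed.

(** Vertices of one face are distinct by planarity. Only the tip and a corner share no face;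
    identifying them would nest a spike triangle in a trapezoid. *)
Let s_uniq : uniq s.
Proof.
rewrite /s.
have u0 := P_uniq (inP (isT : 0 < 6)%N); have u1 := P_uniq (inP (isT : 1 < 6)%N).
have u2 := P_uniq (inP (isT : 2 < 6)%N); have u3 := P_uniq (inP (isT : 3 < 6)%N).
have u4 := P_uniq (inP (isT : 4 < 6)%N); have u5 := P_uniq (inP (isT : 5 < 6)%N).
rewrite /= !inE !negb_or !andbT in u3 u4 u5.
case/and3P: u3 => /and3P[n12 n1C2 n1C1] /andP[n2C2 n2C1] nC21.
case/and3P: u4 => /and3P[n23 n2C3 _] /andP[n3C3 n3C2] nC32.
case/and3P: u5 => /and3P[n31 n3C1 _] /andP[_ n1C3] nC13.
have [nT1 nT2 _] := uniq3 u0; have [_ nT3 _] := uniq3 u1.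
have nest i j : (i < 6)%N -> (j < 6)%N -> forall p q c, nth [::] P i = [:: p; q; c] ->
    [:: p; q; c] != nth [::] P j -> all (mem (nth [::] P j)) [:: p; q; c] -> False.
  move=> /inP + /inP + p q c FE; rewrite FE => FP GP FG /and4P[pG qG cG _].
  exact: (nested_triangle P_poly P_convex FP GP FG).
apply: uniq_hat_points => //; rewrite 1?eq_sym //; apply/eqP => TC.
- apply: (nest 0 3 isT isT T M1 M2 erefl)%N; first by rewrite eqseq_cons (negPf nT1).
  by rewrite /= -TC !inE !eqxx !orbT.
- apply: (nest 0 3 isT isT T M1 M2 erefl)%N; first by rewrite eqseq_cons (negPf nT1).
  by rewrite /= -TC !inE !eqxx !orbT.
- apply: (nest 1 4 isT isT T M2 M3 erefl)%N; first by rewrite eqseq_cons (negPf nT2).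
  by rewrite /= -TC !inE !eqxx !orbT.
Qed.

Lemma basic_hat_open : open_polyhedron P.
Proof.
split; first exact: P_poly.
exists (lab_pair s (4, 5)%N); rewrite P_labels nfaces_at_lab //; exact: s_uniq.
Qed.

Lemma basic_hat_convex_faced : convex_faced P.
Proof. by move=> F FP k; apply: convex_face_interior_angle; exact: P_convex. Qed.

Let star_at (v : nat) (A : seq nat) : (v, A) \in
    [:: (1, [:: 0; 2; 4; 3]); (2, [:: 0; 3; 5; 1]); (3, [:: 0; 1; 6; 2])]%N ->
  exists2 Fs, size Fs = 4%N &
    star P (lab_pt s v) (map (lab_pt s) A) Fs [:: a; pi - b; pi - b; a].
Proof.
case: hat => s1 s2 s3 [t1 t2 t3] _.
have uF (ls : seq (seq nat)) : all (lab_ok s) ls -> uniq ls -> uniq (map (lab_face s) ls).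
  move=> /allP ok; rewrite map_inj_in_uniq // => F G /ok sF /ok sG FG.
  by rewrite -(lab_faceK s_uniq sF) FG lab_faceK.
rewrite !inE => /or3P[] /eqP[-> ->].
- have := @basic_star P T M1 M2 M3 C1 C2 C3.
  set Fs := [:: _; _; _; _] => star1; exists Fs => //; apply: star1 => //.
  + by move=> F; rewrite !inE => /or4P[] /eqP ->; rewrite !eqxx ?orbT.
  + exact: (uF [:: [:: 0; 1; 2]; [:: 1; 2; 5; 4]; [:: 3; 1; 4; 6]; [:: 0; 3; 1]])%N.
- have := @basic_star P T M2 M3 M1 C2 C3 C1.
  set Fs := [:: _; _; _; _] => star1; exists Fs => //; apply: star1 => //.
  + by move=> F; rewrite !inE => /or4P[] /eqP ->; rewrite !eqxx ?orbT.
  + exact: (uF [:: [:: 0; 2; 3]; [:: 2; 3; 6; 5]; [:: 1; 2; 5; 4]; [:: 0; 1; 2]])%N.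
- have := @basic_star P T M3 M1 M2 C3 C1 C2.
  set Fs := [:: _; _; _; _] => star1; exists Fs => //; apply: star1 => //.
  + by move=> F; rewrite !inE => /or4P[] /eqP ->; rewrite !eqxx ?orbT.
  + exact: (uF [:: [:: 0; 3; 1]; [:: 3; 1; 4; 6]; [:: 2; 3; 6; 5]; [:: 0; 2; 3]])%N.
Qed.

Lemma basic_hat_no_unfolding : ~ has_edge_unfolding P.
Proof.
rewrite P_labels; apply: (no_edge_unfolding_lab s_uniq _ _ _ _ _ _ basic_arcs_separate) => //.
move=> E unf arc /allpairsP[[[v A] [j0 k]] [/= vA jk ->]].
have [Fs sFs st] := star_at vA.
apply: (star_arc_edges P_poly P_convex unf st); rewrite sFs.
  by move: jk; rewrite !inE => /or3P[] /eqP[_ ->].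
case/andP: a_bd => a0 _.
(* The excess over 2 pi is a - 2 b without a spike face, and 2 (a - b) for a full turn. *)
by move: jk; rewrite !inE => /or3P[] /eqP[-> ->];
  rewrite !big_ord_recr big_ord0 /= -mulr_natl; move: ba; lra.
Qed.

End BasicHat.

(** * Triangulated hats *)

Section TriangulatedHat.
Variables (R : realType) (a b g : R).
Hypotheses (a_bd : 0 < a < pi) (b_bd : 0 < b < pi / 2) (g_bd : g < pi).

Lemma triangulated_star (P : seq (face R)) (T Ma Mb Mc Ca Cb Cc : 'rV[R]_3) :
  let Fs := [:: [:: T; Ma; Mb]; [:: Ma; Mb; Ca]; [:: Cc; Ca; Ma]; [:: Mc; Ma; Cc];
                [:: T; Mc; Ma]] in
  {subset Fs <= P} -> [:: Ca; Cb; Mb] \in P -> uniq Fs -> (forall F, F \in P -> uniq F) ->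
  spike_ok a T Ma Mb -> spike_ok a T Mc Ma ->
  brim_tri_ok b g Ma Mb Ca Cb -> brim_tri_ok b g Mc Ma Cc Ca ->
  star P Ma [:: T; Mb; Ca; Cc; Mc] Fs
    [:: a; (pi - g) / 2; pi - b *+ 2; (pi - g) / 2; a].
Proof.
move=> Fs FsP GP uFs uP s1 s2 t1 t2.
have uF F : F \in Fs -> uniq F by move/FsP/uP.
have [a1 _] := spike_angles a_bd (uF [:: T; Ma; Mb] ltac:(by rewrite !inE eqxx)) s1.
have [_ a2] := spike_angles a_bd (uF [:: T; Mc; Ma] ltac:(by rewrite !inE eqxx !orbT)) s2.
have [_ b1 _ _] := brim_angles b_bd g_bd
  (uF [:: Ma; Mb; Ca] ltac:(by rewrite !inE eqxx !orbT)) (uP _ GP) t1.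
have [_ _ b2 b3] := brim_angles b_bd g_bd
  (uF [:: Mc; Ma; Cc] ltac:(by rewrite !inE eqxx !orbT))
  (uF [:: Cc; Ca; Ma] ltac:(by rewrite !inE eqxx !orbT)) t2.
split => // -[|[|[|[|[|//]]]]] _; (split; [by apply: FsP; rewrite !inE eqxx ?orbT
  |by rewrite /is_edge_of /same_edge /= !eqxx ?orbT|by rewrite !inE eqxx ?orbT|done]).
Qed.

Variables T M1 M2 M3 C1 C2 C3 : 'rV[R]_3.
Hypothesis ba : 2 * b + g < a.
Hypothesis hat : triangulated_hat a b g T M1 M2 M3 C1 C2 C3.

Let P := triangulated_hat_faces T M1 M2 M3 C1 C2 C3.
Let s := [:: T; M1; M2; M3; C1; C2; C3].

Let P_labels : P = map (lab_face s) triangulated_labels.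
Proof. by []. Qed.

Let P_poly : polyhedron P.
Proof. by case: hat. Qed.

Let P_uniq F : F \in P -> uniq F.
Proof. by case: P_poly => h _ _ _ /h[]. Qed.

Let inP i : (i < 9)%N -> nth [::] P i \in P.
Proof. by move=> i9; exact: mem_nth. Qed.

Let spike_convex (Ma Mb : 'rV[R]_3) : spike_ok a T Ma Mb ->
  [:: T; Ma; Mb] \in P -> convex_face [:: T; Ma; Mb].
Proof.
move=> sp /P_uniq u; have [h _] := spike_angles a_bd u sp.
by apply: triangle_convex; rewrite -gram_rotate gramC; exact: has_angle_gram h.
Qed.

Let brim_convex (Ma Mb Ca Cb : 'rV[R]_3) : brim_tri_ok b g Ma Mb Ca Cb ->
  [:: Ma; Mb; Ca] \in P -> [:: Ca; Cb; Mb] \in P ->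
  convex_face [:: Ma; Mb; Ca] /\ convex_face [:: Ca; Cb; Mb].
Proof.
move=> br /P_uniq u1 /P_uniq u2; have [_ h1 _ h2] := brim_angles b_bd g_bd u1 u2 br.
split; apply: triangle_convex; first exact: has_angle_gram h1.
by rewrite -2!gram_rotate gramC; exact: has_angle_gram h2.
Qed.

Let P_convex F : F \in P -> convex_face F.
Proof.
case: hat => -[s1 s2 s3] [t1 t2 t3] _ _.
have [b1 b2] := brim_convex t1 (inP (isT : 3 < 9)%N) (inP (isT : 4 < 9)%N).
have [b3 b4] := brim_convex t2 (inP (isT : 5 < 9)%N) (inP (isT : 6 < 9)%N).
have [b5 b6] := brim_convex t3 (inP (isT : 7 < 9)%N) (inP (isT : 8 < 9)%N).
have := spike_convex s1 (inP (isT : 0 < 9)%N).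
have := spike_convex s2 (inP (isT : 1 < 9)%N).
have := spike_convex s3 (inP (isT : 2 < 9)%N) => b7 b8 b9.
by rewrite !inE => /or4P[|||/or4P[|||/or3P[]]] /eqP ->.
Qed.

(** Each middle vertex also has an opposite corner with which it shares no face; identifying the two
    would nest one brim triangle in another. *)
Let s_uniq : uniq s.
Proof.
rewrite /s.
have [nT1 nT2 _] := uniq3 (P_uniq (inP (isT : 0 < 9)%N)).
have [_ nT3 _] := uniq3 (P_uniq (inP (isT : 1 < 9)%N)).
have [_ n1C1 n2C1] := uniq3 (P_uniq (inP (isT : 3 < 9)%N)).
have [nC12 _ _] := uniq3 (P_uniq (inP (isT : 4 < 9)%N)).
have [_ n2C2 n3C2] := uniq3 (P_uniq (inP (isT : 5 < 9)%N)).
have [nC23 _ _] := uniq3 (P_uniq (inP (isT : 6 < 9)%N)).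
have [_ n3C3 n1C3] := uniq3 (P_uniq (inP (isT : 7 < 9)%N)).
have [nC31 _ _] := uniq3 (P_uniq (inP (isT : 8 < 9)%N)).
have nest i j : (i < 9)%N -> (j < 9)%N -> forall p q c, nth [::] P i = [:: p; q; c] ->
    p != head 0 (nth [::] P j) -> all (mem (nth [::] P j)) [:: p; q; c] -> False.
  move=> /inP + /inP + p q c FE; rewrite FE => FP GP pG /and4P[pG' qG cG _].
  apply: (nested_triangle P_poly P_convex FP GP) => //.
  by apply: contraNneq pG => <-.
apply: uniq_hat_points; rewrite ?(P_uniq (inP (isT : 0 < 9)%N))
  ?(P_uniq (inP (isT : 1 < 9)%N)) ?(P_uniq (inP (isT : 2 < 9)%N)) //;
  apply/eqP => TC.
- by apply: (nest 0 3 isT isT T M1 M2 erefl)%N; rewrite //= TC !inE !eqxx !orbT.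
- by apply: (nest 1 5 isT isT T M2 M3 erefl)%N; rewrite //= TC !inE !eqxx !orbT.
- by apply: (nest 2 7 isT isT T M3 M1 erefl)%N; rewrite //= TC !inE !eqxx !orbT.
- by apply: (nest 3 4 isT isT M1 M2 C1 erefl)%N; rewrite //= TC !inE !eqxx !orbT.
- by apply: (nest 5 6 isT isT M2 M3 C2 erefl)%N; rewrite //= TC !inE !eqxx !orbT.
- by apply: (nest 7 8 isT isT M3 M1 C3 erefl)%N; rewrite //= TC !inE !eqxx !orbT.
Qed.

Lemma triangulated_hat_open : open_polyhedron P.
Proof.
split; first exact: P_poly.
exists (lab_pair s (4, 5)%N); rewrite P_labels nfaces_at_lab //; exact: s_uniq.
Qed.

Lemma triangulated_hat_convex_faced : convex_faced P.
Proof. by move=> F FP k; apply: convex_face_interior_angle; exact: P_convex. Qed.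

Let star_at (v : nat) (A : seq nat) : (v, A) \in
    [:: (1, [:: 0; 2; 4; 6; 3]); (2, [:: 0; 3; 5; 4; 1]); (3, [:: 0; 1; 6; 5; 2])]%N ->
  exists2 Fs, size Fs = 5%N & star P (lab_pt s v) (map (lab_pt s) A) Fs
    [:: a; (pi - g) / 2; pi - b *+ 2; (pi - g) / 2; a].
Proof.
case: hat => -[s1 s2 s3] [t1 t2 t3] _ _.
have uF (ls : seq (seq nat)) : all (lab_ok s) ls -> uniq ls -> uniq (map (lab_face s) ls).
  move=> /allP ok; rewrite map_inj_in_uniq // => F G /ok sF /ok sG FG.
  by rewrite -(lab_faceK s_uniq sF) FG lab_faceK.
rewrite !inE => /or3P[] /eqP[-> ->].
- have := @triangulated_star P T M1 M2 M3 C1 C2 C3.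
  set Fs := [:: _; _; _; _; _] => star1; exists Fs => //; apply: star1 => //.
  + by move=> F; rewrite !inE => /orP[|/or4P[]] /eqP ->; rewrite !eqxx ?orbT.
  + by rewrite !inE eqxx ?orbT.
  + exact: (uF [:: [:: 0; 1; 2]; [:: 1; 2; 4]; [:: 6; 4; 1]; [:: 3; 1; 6]; [:: 0; 3; 1]])%N.
- have := @triangulated_star P T M2 M3 M1 C2 C3 C1.
  set Fs := [:: _; _; _; _; _] => star1; exists Fs => //; apply: star1 => //.
  + by move=> F; rewrite !inE => /orP[|/or4P[]] /eqP ->; rewrite !eqxx ?orbT.
  + by rewrite !inE eqxx ?orbT.
  + exact: (uF [:: [:: 0; 2; 3]; [:: 2; 3; 5]; [:: 4; 5; 2]; [:: 1; 2; 4]; [:: 0; 1; 2]])%N.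
- have := @triangulated_star P T M3 M1 M2 C3 C1 C2.
  set Fs := [:: _; _; _; _; _] => star1; exists Fs => //; apply: star1 => //.
  + by move=> F; rewrite !inE => /orP[|/or4P[]] /eqP ->; rewrite !eqxx ?orbT.
  + by rewrite !inE eqxx ?orbT.
  + exact: (uF [:: [:: 0; 3; 1]; [:: 3; 1; 6]; [:: 5; 6; 3]; [:: 2; 3; 5]; [:: 0; 2; 3]])%N.
Qed.

Lemma triangulated_hat_no_unfolding : ~ has_edge_unfolding P.
Proof.
rewrite P_labels.
apply: (no_edge_unfolding_lab s_uniq _ _ _ _ _ _ triangulated_arcs_separate) => //.
move=> E unf arc /allpairsP[[[v A] [j0 k]] [/= vA jk ->]].
have [Fs sFs st] := star_at vA.
apply: (star_arc_edges P_poly P_convex unf st); rewrite sFs.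
  by move: jk; rewrite !inE => /or4P[] /eqP[_ ->].
case/andP: a_bd => a0 _; case/andP: b_bd => b0 _.
by move: jk; rewrite !inE => /or4P[] /eqP[-> ->];
  rewrite !big_ord_recr big_ord0 /= -mulr_natl; move: ba; lra.
Qed.

End TriangulatedHat.

Theorem theorem8 (R : realType) :
  (forall (a b l : R) (T M1 M2 M3 C1 C2 C3 : 'rV[R]_3),
      basic_valid a b l -> basic_hat a b l T M1 M2 M3 C1 C2 C3 ->
      2 * b < a ->
      open_polyhedron (basic_hat_faces T M1 M2 M3 C1 C2 C3) /\
      convex_faced (basic_hat_faces T M1 M2 M3 C1 C2 C3) /\
      ~ has_edge_unfolding (basic_hat_faces T M1 M2 M3 C1 C2 C3)) /\
  (forall (a b g : R) (T M1 M2 M3 C1 C2 C3 : 'rV[R]_3),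
      triangulated_valid a b g -> triangulated_hat a b g T M1 M2 M3 C1 C2 C3 ->
      2 * b + g < a ->
      open_polyhedron (triangulated_hat_faces T M1 M2 M3 C1 C2 C3) /\
      convex_faced (triangulated_hat_faces T M1 M2 M3 C1 C2 C3) /\
      ~ has_edge_unfolding (triangulated_hat_faces T M1 M2 M3 C1 C2 C3)).
Proof.
have pi0 := pi_gt0 R.
split=> [a b l|a b g] T M1 M2 M3 C1 C2 C3.
  move=> [/andP[a1 a2] /andP[b1 b2] l1] hat ba.
  have a_bd : 0 < a < pi by apply/andP; split; lra.
  have b_bd : 0 < b < pi by apply/andP; split; lra.
  split; first exact: (basic_hat_open a_bd b_bd l1 hat).
  split; first exact: (basic_hat_convex_faced a_bd b_bd l1 hat).
  exact: (basic_hat_no_unfolding a_bd b_bd l1 ba hat).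
move=> [/andP[a1 a2] /andP[b1 b2] g1] hat ba.
(* Validity bounds [g] only from above; it is nonnegative because it is the angle of a nondegenerate
   face. *)
have g0 : 0 <= g.
  have [_ [[<- _ _ _] _ _] _ [planar _ _ _]] := hat.
  have [|_ u _ _] := planar [:: M1; M2; C1]; first by rewrite !inE eqxx !orbT.
  by have [_ n1 n2] := uniq3 u; apply: vangle_ge0; rewrite subr_eq0.
have a_bd : 0 < a < pi by apply/andP; split; lra.
(* The lower bound combines pi / 6 <= b + g / 2 with g < pi / 3; the upper one uses [g0]. *)
have b_bd : 0 < b < pi / 2 by apply/andP; split; lra.
have g_bd : g < pi by lra.
split; first exact: (triangulated_hat_open a_bd b_bd g_bd hat).
split; first exact: (triangulated_hat_convex_faced a_bd b_bd g_bd hat).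
exact: (triangulated_hat_no_unfolding a_bd b_bd g_bd ba hat).
Qed.
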